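(* Let $A$ be a Banach $\ast$-algebra with center $Z$. If the vector subspace $ZA^{2}$ of $A$ is closed in $A$ and of finite codimension in $A$, then every positive linear functional on $A$ is continuous.
   Context: A Banach $\ast$-algebra is a complex (associative, not necessarily unital) Banach algebra equipped with an involution $x\mapsto x^{\ast}$ (conjugate-linear, $(xy)^{\ast}=y^{\ast}x^{\ast}$, $(x^{\ast})^{\ast}=x$); the involution is not assumed to be continuous. The center is $Z=\{z\in A : za=az \text{ for all } a\in A\}$. A linear functional $f$ on $A$ is positive if $f(x^{\ast}x)\geq 0$ for all $x\in A$. For vector subspaces $X,Y$ of $A$, $XY$ denotes the vector subspace of $A$ spanned by the products $xy$ with $x\in X$, $y\in Y$; for $n\geq 2$, $X^{n}$ denotes the vector subspace of $A$ spanned by the products $x_{1}\cdots x_{n}$ with $x_{i}\in X$ $(1\leq i\leq n)$. Thus $ZA^{2}$ is the linear span of the products $zxy$ with $z\in Z$ and $x,y\in A$. Continuity is with respect to the norm topology of $A$. *)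

(* Defs.v *)
(* MathComp / MathComp-Analysis *)
From HB Require Import structures.
From mathcomp Require Import all_boot all_order all_algebra.
From mathcomp Require Import complex.
From mathcomp Require Import all_classical all_reals all_analysis.
Set Implicit Arguments.
Unset Strict Implicit.
Unset Printing Implicit Defensive.

Import Order.TTheory GRing.Theory Num.Theory.
Import numFieldNormedType.Exports.

Local Open Scope classical_set_scope.
Local Open Scope ring_scope.
Local Open Scope complex_scope.

(* The ring structures of MathComp are unital, so the product is a separate
   operation on the underlying Banach space. The involution is not required to
   be continuous. *)
HB.mixin Record CompleteNormedModule_isBanachStarAlg (R : realType) A
    of CompleteNormedModule R[i] A := {
  amul : A -> A -> A;
  star : A -> A;
  amulA : forall x y z, amul x (amul y z) = amul (amul x y) z;
  amulDl : forall x y z, amul (x + y) z = amul x z + amul y z;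
  amulDr : forall x y z, amul x (y + z) = amul x y + amul x z;
  amulZl : forall (a : R[i]) x y, amul (a *: x) y = a *: amul x y;
  amulZr : forall (a : R[i]) x y, amul x (a *: y) = a *: amul x y;
  norm_amul : forall x y, `|amul x y| <= `|x| * `|y|;
  starD : forall x y, star (x + y) = star x + star y;
  starZ : forall (a : R[i]) x, star (a *: x) = Num.conj a *: star x;
  starM : forall x y, star (amul x y) = amul (star y) (star x);
  starK : forall x, star (star x) = x
}.

#[short(type="banachStarAlgType")]
HB.structure Definition BanachStarAlg (R : realType) :=
  {A of CompleteNormedModule_isBanachStarAlg R A & CompleteNormedModule R[i] A}.

Declare Scope banach_star_scope.
Delimit Scope banach_star_scope with A.
Notation "x ** y" := (amul x y)
  (at level 40, left associativity) : banach_star_scope.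
Local Open Scope banach_star_scope.

Section LinearSpan.
Variables (K : pzRingType) (V : lmodType K).

Definition lin_span (S : set V) : set V :=
  [set v | exists (n : nat) (c : 'I_n -> K) (s : 'I_n -> V),
     (forall i, S (s i)) /\ v = \sum_(i < n) c i *: s i].

(* The quotient V / W is spanned by the classes of finitely many vectors;
   meaningful when W is a vector subspace. *)
Definition finite_codim (W : set V) : Prop :=
  exists (n : nat) (e : 'I_n -> V), forall v : V,
    exists c : 'I_n -> K, W (v - \sum_(i < n) c i *: e i).

Lemma sub_lin_span (S : set V) : S `<=` lin_span S.
Proof.
move=> v Sv; exists 1%N, (fun=> 1), (fun=> v); split=> //.
by rewrite big_ord1 scale1r.
Qed.

Lemma lin_span0 (S : set V) : lin_span S 0.
Proof. by exists 0%N, (fun=> 0), (fun=> 0); split=> [[]|]; rewrite ?big_ord0. Qed.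

Lemma lin_spanD (S : set V) (u v : V) :
  lin_span S u -> lin_span S v -> lin_span S (u + v).
Proof.
move=> [m [c [s [Ss ->]]]] [n [d [t [St ->]]]].
pose cd i := match fintype.split i with inl j => c j | inr k => d k end.
pose st i := match fintype.split i with inl j => s j | inr k => t k end.
exists (m + n)%N, cd, st; split=> [i|]; first by rewrite /st; case: fintype.split.
rewrite big_split_ord /=; congr (_ + _); apply: eq_bigr => i _.
  by rewrite /cd /st (unsplitK (inl i)).
by rewrite /cd /st (unsplitK (inr i)).
Qed.

Lemma lin_spanZ (S : set V) (a : K) (u : V) :
  lin_span S u -> lin_span S (a *: u).
Proof.
move=> [n [c [s [Ss ->]]]]; exists n, (fun i => a * c i), s; split=> //.
by rewrite scaler_sumr; apply: eq_bigr => i _; rewrite scalerA.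
Qed.

Lemma lin_span_sum (S : set V) (n : nat) (F : 'I_n -> V) :
  (forall i, lin_span S (F i)) -> lin_span S (\sum_(i < n) F i).
Proof.
move=> SF; elim/big_ind: _ => //; [exact: lin_span0 | exact: lin_spanD].
Qed.

End LinearSpan.

Section BanachStarAlg.
Variables (R : realType) (A : banachStarAlgType R).

Definition center : set A := [set z | forall a : A, z ** a = a ** z].

Definition prod_space (X Y : set A) : set A :=
  lin_span [set v | exists x y, [/\ X x, Y y & v = x ** y]].

Definition ZA2 : set A := prod_space center (prod_space setT setT).

(* The order on R[i] makes 0 <= w mean that w is real and nonnegative. *)
Definition positive_functional (f : A -> R[i]) : Prop :=
  forall x : A, 0 <= f (star x ** x).

Lemma ZA2E :
  ZA2 = lin_span [set v | exists z x y, center z /\ v = z ** (x ** y)].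
Proof.
have amul0r (x : A) : x ** 0 = 0.
  by have := amulZr 0 x x; rewrite !scale0r.
rewrite /ZA2 /prod_space; apply/seteqP; split=> v [n [c [s [Ss ->]]]];
    apply: lin_span_sum => i; apply: lin_spanZ; have := Ss i.
  move=> [z [w [Zz [m [d [t [Tt ->]]]] ->]]].
  rewrite (big_morph (amul z) (amulDr z) (amul0r z)).
  apply: lin_span_sum => j; rewrite amulZr; apply: lin_spanZ.
  have [x [y [_ _ ->]]] := Tt j.
  by apply: sub_lin_span; exists z, x, y.
move=> [z [x [y [Zz ->]]]]; apply: sub_lin_span; exists z, (x ** y).
by split=> //; apply: sub_lin_span; exists x, y.
Qed.

End BanachStarAlg.

Arguments center {R} A _.
Arguments ZA2 {R} A _.

(* Main.v *)
(* Write x' for the adjoint of x. Let f be positive, <x, y> = f(x'y) its GNS form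
   and p the GNS seminorm.

   Step 1. On a unital Banach star-algebra positive functionals are continuous.
   For small hermitian h, Ford's square root lemma writes 1 - h as a hermitian
   square, so f is dominated on hermitian elements by the spectral radius. By
   the Johnson-Ransford argument the separating space of the involution is an
   ideal of quasinilpotents, and by the open mapping theorem the involution is
   bounded modulo this ideal; hence f(x'x) = O(|x|^2).

   Step 2. Applied on the unitization to the functionals f(c' . c), step 1 gives
   the continuity of f(b . c). Since f((za)'x) = f(a'xz') for central z, the
   uniform boundedness principle gives p = O(|.|) on ZA, hence on ZA^2; as ZA^2
   is closed of finite codimension, p = O(|.|) on A.

   Step 3. Since f(z w x y) = <(w x)', z y> for z, w in Z, the functionals f(z .),
   with z in Z acting as a uniformly bounded operator for p, are pointwise
   bounded on ZA^2, hence uniformly bounded there. Polynomials in the elements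
   w'w, w in Z, provide such z with f(z u) close to f(u), for every u in ZA^2. *)

From HB Require Import structures.
Require Import Defs.
From mathcomp Require Import all_boot all_order all_algebra.
From mathcomp Require Import separable cyclic cyclotomic.
From mathcomp Require Import complex.
From mathcomp Require Import all_classical all_reals all_analysis.
From mathcomp Require Import ring lra zify.
Set Implicit Arguments.
Unset Strict Implicit.
Unset Printing Implicit Defensive.
Import Order.TTheory GRing.Theory Num.Theory.
Import numFieldNormedType.Exports.
Local Open Scope classical_set_scope.
Local Open Scope ring_scope.
Local Open Scope complex_scope.

(** * Complete norms *)

(** The obstacle is the possible discontinuity of the involution. A norm limit of hermitian elements
    need not be hermitian, and [x'x] need not be [O(|x|^2)], so square roots and norm estimates
    cannot simply be carried through [star]. What the involution does preserve is invertibility: the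
    spectral radius of an element is controlled by the norm of its adjoint as well as by its own
    norm. Step 1 therefore speaks of powers and resolvents rather than of norms.

    No holomorphic function theory enters. Finite averages over roots of unity stand for Cauchy's
    integral, and compactness of a parameter box makes resolvent bounds uniform.

    Step 3 cannot be shortened to an appeal to the continuity of [p]. Without a unit, Cauchy-Schwarz
    estimates [f] only on products, [|f(xy)| <= p(x') p(y)], and [x'] is not controlled by [x].
    Inserting [z] helps because a central [z] can be moved next to the last factor, leaving the
    first factor fixed. *)

Section ComplexModulus.
Variable R : realType.
Implicit Types (a b : R[i]) (t e : R).

(** The norm of [R[i]] takes its values in [R[i]], whose order is partial; a modulus with values in
    [R] makes linear real arithmetic available. *)
Definition cabs a : R := complex.Re `|a|.

Lemma cabsE a : (cabs a)%:C = `|a|.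
Proof. by rewrite /cabs RRe_real ?normr_real. Qed.

Lemma cabs_ge0 a : 0 <= cabs a.
Proof. by rewrite -ler0c cabsE. Qed.

Lemma cabsM a b : cabs (a * b) = cabs a * cabs b.
Proof. by apply: complexI; rewrite rmorphM !cabsE normrM. Qed.

Lemma cabsD a b : cabs (a + b) <= cabs a + cabs b.
Proof. by rewrite -lecR rmorphD !cabsE; exact: ler_normD. Qed.

Lemma cabsN a : cabs (- a) = cabs a.
Proof. by apply: complexI; rewrite !cabsE normrN. Qed.

Lemma cabsX a n : cabs (a ^+ n) = cabs a ^+ n.
Proof. by apply: complexI; rewrite rmorphXn !cabsE normrX. Qed.

Lemma cabs_real t : cabs t%:C = `|t|.
Proof.
apply: complexI; rewrite cabsE normc_def /= expr0n addr0 sqrtr_sqr.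
by [].
Qed.

Lemma cabs1 : cabs 1 = 1.
Proof. by have := cabs_real 1; rewrite normr1. Qed.

Lemma cabs0 : cabs 0 = 0.
Proof. by have := cabs_real 0; rewrite normr0. Qed.

Lemma cabs_eq0 a : cabs a = 0 -> a = 0.
Proof.
by move=> a0; apply/normr0_eq0; rewrite -cabsE a0.
Qed.

Lemma cabs_conj a : cabs (Num.conj a) = cabs a.
Proof. by apply: complexI; rewrite !cabsE norm_conjC. Qed.

Lemma cabs_i : cabs 'i = 1.
Proof.
by apply: complexI; rewrite cabsE normc_def /= expr0n add0r expr1n sqrtr1.
Qed.

Lemma cabs_ReIm a : cabs a <= `|complex.Re a| + `|complex.Im a|.
Proof.
case: a => s t /=; have -> : s +i* t = s%:C + 'i * t%:C by simpc.
by apply: le_trans (cabsD _ _) _; rewrite cabsM !cabs_real cabs_i mul1r.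
Qed.

Lemma cabs_ge_Re a : `|complex.Re a| <= cabs a.
Proof. by rewrite -lecR cabsE normc_ge_Re. Qed.

Lemma cabs_ge_Im a : `|complex.Im a| <= cabs a.
Proof.
by have := cabs_ge_Re (a * 'i); rewrite cabsM cabs_i mulr1 ReiNIm normrN.
Qed.

Lemma cabs_Re a : complex.Re a <= cabs a.
Proof. by apply: le_trans (cabs_ge_Re a); exact: ler_norm. Qed.

End ComplexModulus.

Section RealArith.
Variable R : realType.
Implicit Types (x y t e : R).

Lemma le_of_forall_eps x y : (forall e : R, 0 < e -> x <= y + e) -> x <= y.
Proof. by move=> h; apply/ler_addgt0Pr => e /h. Qed.

Lemma expr2n_large x : exists n : nat, x <= 2 ^+ n.
Proof.
exists (Num.bound `|x|).
apply: le_trans (ler_norm x) _; apply/ltW.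
apply: (lt_le_trans (archi_boundP (normr_ge0 x))).
rewrite -natrX ler_nat; exact/ltnW/ltn_expl.
Qed.

Lemma geom_small x e : 0 < e -> exists n : nat, x / 2 ^+ n <= e.
Proof.
move=> e0; have [n hn] := expr2n_large (x / e); exists n.
rewrite ler_pdivrMr ?exprn_gt0 // mulrC -ler_pdivrMr //.
Qed.

End RealArith.

Lemma subrB_swap (V : zmodType) (a b c d : V) :
  (a - b) - (c - d) = (a - c) - (b - d).
Proof. by rewrite !opprB addrACA [RHS]addrACA [- b - c]addrC. Qed.

Section CompleteNorm.
Variable R : realType.

(** Completeness is asked only of sequences with geometric steps, together with the explicit rate
    obtained by summing the tail. Norms thus stay plain real functions, easily put on products,
    finite families and the unitization. *)
Record complete_norm (V : lmodType R[i]) (N : V -> R) : Prop := CompleteNorm {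
  cn_triangle : forall x y, N (x + y) <= N x + N y;
  cn_scale : forall a x, N (a *: x) = cabs a * N x;
  cn_eq0 : forall x, N x = 0 -> x = 0;
  cn_complete : forall (u : nat -> V) (D : R),
    (forall n, N (u n.+1 - u n) <= D / 2 ^+ n) ->
    exists l, forall n, N (l - u n) <= D * 2 / 2 ^+ n
}.

Section Theory.
Variables (V : lmodType R[i]) (N : V -> R) (cN : complete_norm N).

Lemma cn0 : N 0 = 0.
Proof. by rewrite -(scale0r 0) (cn_scale cN) cabs0 mul0r. Qed.

Lemma cnN x : N (- x) = N x.
Proof. by rewrite -scaleN1r (cn_scale cN) cabsN cabs1 mul1r. Qed.

Lemma cn_ge0 x : 0 <= N x.
Proof.
have := cn_triangle cN x (- x); rewrite subrr cn0 cnN; lra.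
Qed.

Lemma cnB x y : N (x - y) <= N x + N y.
Proof. by rewrite -(cnN y); exact: cn_triangle. Qed.

Lemma cnC x y : N (x - y) = N (y - x).
Proof. by rewrite -cnN opprB. Qed.

Lemma cn_dist z x y : N (x - y) <= N (x - z) + N (z - y).
Proof. by apply: le_trans (cn_triangle cN _ _); rewrite addrA subrK. Qed.

Lemma cn_real (t : R) x : N (t%:C *: x) = `|t| * N x.
Proof. by rewrite (cn_scale cN) cabs_real. Qed.

Lemma cn_gt0 x : x <> 0 -> 0 < N x.
Proof.
by move=> x0; rewrite lt_neqAle cn_ge0 andbT; apply/eqP => h; apply/x0/(cn_eq0 cN).
Qed.

Lemma cn_sum (I : Type) (r : seq I) (F : I -> V) :
  N (\sum_(i <- r) F i) <= \sum_(i <- r) N (F i).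
Proof.
elim/big_ind2: _ => //; first by rewrite cn0.
by move=> x1 x2 y1 y2 h1 h2; apply: le_trans (cn_triangle cN _ _) (lerD h1 h2).
Qed.

Lemma cn_limit_unique x y : (forall e : R, 0 < e -> N (x - y) <= e) -> x = y.
Proof.
move=> h; apply/eqP; rewrite -subr_eq0; apply/eqP/(cn_eq0 cN)/eqP.
rewrite eq_le cn_ge0 andbT; apply/le_of_forall_eps => e /h.
by rewrite add0r.
Qed.

(** Step bounds that at least halve sum to at most twice the current one. This is the limit point of
    a nested ball construction; the doubled radius reappears in the two category arguments below. *)
Lemma nested_limit (u : nat -> V) (d : nat -> R) :
  (forall n, N (u n.+1 - u n) <= d n) -> (forall n, d n.+1 <= d n / 2) ->
  exists l, forall n, N (l - u n) <= 2 * d n.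
Proof.
move=> hu hd.
have dle m n : d (m + n)%N <= d m / 2 ^+ n.
  elim: n => [|n IH]; first by rewrite addn0 expr0 divr1.
  rewrite addnS exprS invfM; apply: le_trans (hd _) _.
  move: IH; set a := d m; set b := d (m + n)%N => IH.
  by rewrite mulrCA mulrC ler_pM2l ?invr_gt0.
have [|l hl] := @cn_complete _ _ cN u (d 0%N).
  by move=> n; apply: le_trans (hu n) _; exact: (dle 0%N).
exists l => m; apply: le_of_forall_eps => e e0.
have ht n : N (u (m + n)%N - u m) <= 2 * d m - 2 * d (m + n)%N.
  elim: n => [|n IH]; first by rewrite addn0 !subrr cn0.
  rewrite addnS; apply: le_trans (cn_dist (u (m + n)%N) _ _) _.
  by have := hu (m + n)%N; have := hd (m + n)%N; lra.
have d0 n : 0 <= d n by apply: le_trans (cn_ge0 _) (hu n).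
have [n hn] := geom_small (d 0%N * 2) e0.
apply: le_trans (cn_dist (u (m + n)%N) _ _) _.
have := ht n; have := hl (m + n)%N; have := d0 (m + n)%N.
have : d 0%N * 2 / 2 ^+ (m + n) <= d 0%N * 2 / 2 ^+ n.
  rewrite ler_wpM2l ?mulr_ge0 ?d0 // lef_pV2 ?posrE ?exprn_gt0 //.
  by rewrite ler_eXn2l ?leq_addl // ltrDl.
lra.
Qed.

End Theory.

Section BoundedSelection.
Variables (V W : lmodType R[i]) (NV : V -> R) (NW : W -> R).
Variables (cV : complete_norm NV) (cW : complete_norm NW).
Variable G : V -> W -> Prop.
Hypothesis GB : forall x y x' y', G x y -> G x' y' -> G (x - x') (y - y').
Hypothesis GZ : forall (t : R) x y, G x y -> G (t%:C *: x) (t%:C *: y).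
Hypothesis Gclosed : forall x y,
  (forall e : R, 0 < e ->
     exists x' y', [/\ G x' y', NV (x - x') <= e & NW (y - y') <= e]) -> G x y.
Hypothesis Gtotal : forall x, exists y, G x y.

Let level (m : nat) x := exists y, G x y /\ NW y <= m%:R.

(** Baire's argument: if every level missed some ball inside every ball, shrinking balls would
    converge to a point outside all levels, contradicting [Gtotal]. *)
Lemma level_somewhere_dense : exists (m : nat) (x0 : V) (r : R), 0 < r /\
  forall x, NV (x - x0) <= r -> forall e : R, 0 < e ->
  exists x', NV (x - x') <= e /\ level m x'.
Proof.
apply: contrapT => hno.
have step (m : nat) (s : V * {r : R | 0 < r}) : exists s' : V * {r : R | 0 < r},
    [/\ NV (s'.1 - s.1) <= val s.2, val s'.2 <= val s.2 / 2 &
        forall x', NV (x' - s'.1) <= 2 * val s'.2 -> ~ level m x'].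
  case: s => x0 [r r0] /=; apply: contrapT => hs; apply: hno.
  exists m, x0, r; split => // x hx e e0; apply: contrapT => hx'; apply: hs.
  (* The bound [r / 2] makes the radii halve; [e / 2] keeps the ball of doubled radius, where the
     limit will lie, inside the region that misses level [m]. *)
  have d0 : 0 < Num.min (r / 2) (e / 2) by rewrite lt_min !divr_gt0.
  exists (x, exist (fun r : R => is_true (0 < r)) _ d0); split => //=; first by rewrite ge_min lexx.
  move=> x' hd lx'; apply: hx'; exists x'; split=> //.
  rewrite (cnC cV); apply: le_trans hd _.
  have : Num.min (r / 2) (e / 2) <= e / 2 by rewrite ge_min lexx orbT.
  lra.
have [f hf] := choice (fun ms => step ms.1 ms.2).
pose s := fix s n := if n is m.+1 then f (m, s m)
  else (0 : V, exist (fun r : R => is_true (0 < r)) 1 (@ltr01 R)).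
have [n|n|l hl] := @nested_limit _ _ cV (fun n => (s n).1) (fun n => val (s n).2).
- by have [] := hf (n, s n).
- by have [] := hf (n, s n).
have [y hy] := Gtotal l.
have [_ _ /(_ l)] := hf (Num.bound (NW y), s (Num.bound (NW y))).
move=> /(_ (hl (Num.bound (NW y)).+1)); apply; exists y; split => //.
exact/ltW/archi_boundP/(cn_ge0 cW).
Qed.

(** The open mapping theorem for a closed, real-linear, everywhere defined relation [G]. Since [G]
    may be multivalued, it covers maps modulo a subspace without forming a quotient. *)
Lemma bounded_selection :
  exists C : R, 0 < C /\ forall x, exists y, G x y /\ NW y <= C * NV x.
Proof.
have [m [x0 [r [r0 hr]]]] := level_somewhere_dense.
(* Symmetrization moves the ball to the origin: half the difference of approximations of [x0 + x]
   and [x0 - x] approximates [x], and the level [m] is kept. *)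
have approx x e : NV x <= r -> 0 < e -> exists x', NV (x - x') <= e /\ level m x'.
  move=> hx e0.
  have [|x1 [h1 [y1 [G1 b1]]]] := hr (x0 + x) _ _ e0.
    by rewrite addrAC subrr add0r.
  have [|x2 [h2 [y2 [G2 b2]]]] := hr (x0 - x) _ _ e0.
    by rewrite addrAC subrr add0r (cnN cV).
  exists (2^-1%:C *: (x1 - x2)); split; last first.
    exists (2^-1%:C *: (y1 - y2)); split; first exact/GZ/GB.
    rewrite (cn_real cW) ger0_norm ?invr_ge0 //.
    by have := cnB cW y1 y2; lra.
  have -> : x - 2^-1%:C *: (x1 - x2)
          = 2^-1%:C *: ((x0 + x - x1) - (x0 - x - x2)).
    rewrite subrB_swap [x0 + x]addrC addrKA opprK -mulr2n -(scaler_nat 2 x).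
    rewrite [in RHS]scalerBr scalerA.
    rewrite (_ : 2^-1%:C * 2%:R = 1) ?scale1r //.
    by rewrite -(rmorph_nat (real_complex R)) -rmorphM /= mulVf ?pnatr_eq0.
  rewrite (cn_real cV) ger0_norm ?invr_ge0 //.
  by have := cnB cV (x0 + x - x1) (x0 - x - x2); lra.
(* Successive approximation at scale [2 ^- k]: each correction halves the remainder at geometric
   cost. The pair [(0, 0)] is a default for [x] out of range, so that choice applies. *)
have half k x : exists p : V * W, NV x <= r / 2 ^+ k ->
    [/\ G p.1 p.2, NW p.2 <= m%:R / 2 ^+ k & NV (x - p.1) <= r / 2 ^+ k.+1].
  have [hx|] := boolP (NV x <= r / 2 ^+ k); last by exists (0, 0).
  pose c : R := 2 ^+ k; have c0 : 0 < c by rewrite exprn_gt0.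
  have e0 : 0 < r / 2 by rewrite divr_gt0.
  have [|x' [hx' [y [Gy hy]]]] := approx (c%:C *: x) _ _ e0.
    by rewrite (cn_real cV) gtr0_norm // mulrC -ler_pdivlMr.
  exists (c^-1%:C *: x', c^-1%:C *: y) => _ /=; split; first exact: GZ.
    rewrite (cn_real cW) ger0_norm ?invr_ge0 ?(ltW c0) // -/c [leLHS]mulrC.
    by rewrite ler_pM2r ?invr_gt0.
  have -> : x - c^-1%:C *: x' = c^-1%:C *: (c%:C *: x - x').
    rewrite scalerBr scalerA -rmorphM /= mulVf ?rmorph1 ?scale1r //.
    by rewrite gt_eqF.
  rewrite (cn_real cV) ger0_norm ?invr_ge0 ?(ltW c0) // exprS invfM mulrA -/c [leLHS]mulrC.
  by rewrite ler_pM2r ?invr_gt0.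
have [f hf] := choice (fun kx => half kx.1 kx.2).
have small x : NV x <= r -> exists y, G x y /\ NW y <= m%:R * 2.
  move=> hx.
  pose s := fix s n := if n is k.+1 then
     (s k + f (k, x - (s k).1)) else (0 : V * W).
  have G0 : G 0 0.
    by have [y /(GZ 0)] := Gtotal 0; rewrite rmorph0 !scale0r.
  have GD x1 y1 x2 y2 : G x1 y1 -> G x2 y2 -> G (x1 + x2) (y1 + y2).
    by move=> G1 G2; have := GB G1 (GB G0 G2); rewrite !sub0r !opprK.
  have inv n : G (s n).1 (s n).2 /\ NV (x - (s n).1) <= r / 2 ^+ n.
    elim: n => [|n [IG IN]]; first by rewrite expr0 divr1 subr0.
    have [/= h1 h2 h3] := hf (n, x - (s n).1) IN.
    by split; [exact: GD | rewrite opprD addrA].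
  have [n|l hl] := cn_complete cW (u := fun n => (s n).2) (D := m%:R).
    have [_ IN] := inv n; have [/= h1 h2 h3] := hf (n, x - (s n).1) IN.
    by rewrite addrAC subrr add0r.
  exists l; split; last by have := hl 0%N; rewrite expr0 divr1 subr0.
  apply: Gclosed => e e0.
  have [n1 h1] := geom_small r e0; have [n2 h2] := geom_small (m%:R * 2) e0.
  have mono (a : R) (i j : nat) : 0 <= a -> (i <= j)%N -> a / 2 ^+ j <= a / 2 ^+ i.
    move=> a0 ij; rewrite ler_wpM2l // lef_pV2 ?posrE ?exprn_gt0 //.
    by rewrite ler_eXn2l // ltrDl.
  exists (s (n1 + n2)%N).1, (s (n1 + n2)%N).2; have [hG hN] := inv (n1 + n2)%N.
  split => //.
    by apply: le_trans hN (le_trans (mono _ _ _ (ltW r0) (leq_addr _ _)) h1).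
  apply: le_trans (hl _) (le_trans (mono _ _ _ _ (leq_addl _ _)) h2).
  by rewrite mulr_ge0 ?ler0n.
exists (m%:R * 2 / r + 1); split.
  by rewrite ltr_wpDl // divr_ge0 ?mulr_ge0 ?ler0n // ltW.
move=> x; have [x0'|/eqP/(cn_gt0 cV) xgt0] := eqVneq x 0.
  exists 0; rewrite x0' (cn0 cV) (cn0 cW) mulr0; split => //.
  by have [y /(GZ 0)] := Gtotal 0; rewrite rmorph0 !scale0r.
pose t := r / NV x; have t0 : 0 < t by rewrite divr_gt0.
have [|y [Gy hy]] := small (t%:C *: x).
  by rewrite (cn_real cV) gtr0_norm // divfK // gt_eqF.
exists (t^-1%:C *: y); split.
  have := GZ t^-1 Gy; rewrite scalerA -rmorphM /= mulVf ?rmorph1 ?scale1r //.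
  by rewrite gt_eqF.
rewrite (cn_real cW) gtr0_norm ?invr_gt0 //.
apply: (@le_trans _ _ (t^-1 * (m%:R * 2))).
  by rewrite ler_pM2l ?invr_gt0.
by rewrite /t invf_div mulrDl mul1r 
    (_ : _ * (m%:R * 2) = m%:R * 2 / r * NV x) ?lerDl ?ltW //; ring.
Qed.

End BoundedSelection.

(* The gliding hump replaces Baire's theorem: it works on a closed subset
   directly. *)
Lemma uniform_boundedness (V : lmodType R[i]) (N : V -> R) (cN : complete_norm N)
    (W : V -> Prop) (I : Type) (q : I -> V -> R) (K : I -> R) :
  (forall x y, W x -> W y -> W (x + y)) ->
  (forall (t : R) x, W x -> W (t%:C *: x)) ->
  (forall x, (forall e : R, 0 < e -> exists y, W y /\ N (x - y) <= e) -> W x) ->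
  (forall i x y, q i (x + y) <= q i x + q i y) ->
  (forall i (t : R) x, q i (t%:C *: x) = `|t| * q i x) ->
  (forall i x, W x -> q i x <= K i * N x) ->
  (forall x, W x -> exists M, forall i, q i x <= M) ->
  exists C, 0 < C /\ forall i x, W x -> q i x <= C * N x.
Proof.
move=> WD WZ Wcl qD qZ qK qM; apply: contrapT => hno.
have qN i x : q i (- x) = q i x.
  have := qZ i (-1) x; rewrite rmorphN rmorph1 scaleN1r => ->.
  by rewrite normrN normr1 mul1r.
have WN x : W x -> W (- x).
  by move=> /(WZ (-1)); rewrite rmorphN rmorph1 scaleN1r.
have unbounded (C : R) : 0 < C -> exists i x, W x /\ C * N x < q i x.
  move=> C0; apply: contrapT => h; apply: hno; exists C; split => // i x Wx.
  by rewrite leNgt; apply/negP => hlt; apply: h; exists i, x.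
pose state := ({x : V | W x} * {d : R | 0 < d})%type.
have step (n : nat) (s : state) : exists s' : state,
    [/\ N (sval s'.1 - sval s.1) <= val s.2, val s'.2 <= val s.2 / 2 &
        exists i, n%:R + 3 <= q i (sval s'.1) /\ `|K i| * val s'.2 <= 1].
  case: s => -[x Wx] [d d0] /=.
  (* After rescaling [y] to norm [d] the seminorm [q i] is at least [n + 3]; a loss of 2 in the
     limit is still to come. *)
  have [|i [y [Wy hy]]] := unbounded ((n%:R + 3) / d).
    by rewrite divr_gt0 // ltr_wpDl ?ler0n.
  have Ny : 0 < N y.
    apply: cn_gt0 => // y0; move: hy; rewrite y0 (cn0 cN) mulr0.
    by have := qZ i 0 0; rewrite scale0r normr0 mul0r => ->; rewrite ltxx.
  pose y1 := (d / N y)%:C *: y.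
  have Wy1 : W y1 by exact: WZ.
  have Ny1 : N y1 = d.
    by rewrite (cn_real cN) gtr0_norm ?divr_gt0 // divfK // gt_eqF.
  have qy1 : n%:R + 3 <= q i y1.
    rewrite qZ gtr0_norm ?divr_gt0 //.
    move: hy; rewrite mulrAC ltr_pdivrMr // => hy.
    by rewrite mulrAC ler_pdivlMr // [d * _]mulrC ltW.
  (* The hump survives on one side: [2 y1] is the difference of [x + y1] and [x - y1], so [q i] is
     at least [n + 3] at one of them. *)
  have [x' [Wx' hx' qx']] : exists x', [/\ W x', N (x' - x) <= d & n%:R + 3 <= q i x'].
    have [h|h] := lerP (n%:R + 3) (q i (x + y1)).
      exists (x + y1); split => //; first exact: WD.
      by rewrite addrAC subrr add0r Ny1.
    exists (x - y1); split; first exact/WD/WN.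
      by rewrite addrAC subrr add0r (cnN cN) Ny1.
    have := qD i (x + y1) (- (x - y1)); rewrite qN.
    rewrite opprB addrC addrA subrK -mulr2n -(scaler_nat 2 y1).
    rewrite -(rmorph_nat (real_complex R)) qZ ger0_norm ?ler0n //.
    by move: h qy1; lra.
  have K1 : 0 < `|K i| + 1 by rewrite ltr_wpDl.
  (* All later moves total at most twice this radius, so they change [q i] by at most 2, whatever
     the individual constant [K i]. *)
  have d0' : 0 < Num.min (d / 2) (`|K i| + 1)^-1.
    by rewrite lt_min divr_gt0 ?invr_gt0.
  exists (exist _ x' Wx', exist (fun r : R => is_true (0 < r)) _ d0'); split => //=.
    by rewrite ge_min lexx.
  exists i; split => //.
  apply: (@le_trans _ _ (`|K i| * (`|K i| + 1)^-1)).
    by rewrite ler_wpM2l // ge_min lexx orbT.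
  by rewrite ler_pdivrMr // mul1r lerDl.
have [f hf] := choice (fun ms => step ms.1 ms.2).
have W0 : exists x, W x.
  by have [//|i [x [Wx _]]] := unbounded 1; exists x.
case: W0 => w0 Ww0.
pose s := fix s n := if n is m.+1 then f (m, s m)
          else ((exist _ w0 Ww0, exist (fun r : R => is_true (0 < r)) 1 (@ltr01 R)) : state).
have [n|n|l hl] := @nested_limit _ _ cN (fun n => sval (s n).1) (fun n => val (s n).2).
- by have [] := hf (n, s n).
- by have [] := hf (n, s n).
have d_le n : val (s n).2 <= 1 / 2 ^+ n.
  elim: n => [|n IH]; first by rewrite expr0 divr1.
  have [_ h _] := hf (n, s n); apply: le_trans h _.
  by rewrite exprS invfM mul1r mulrC ler_pM2l ?invr_gt0 // -[_^-1]mul1r.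
have Wl : W l.
  apply: Wcl => e e0; have [n hn] := geom_small 2 e0.
  exists (sval (s n).1); split; first exact: svalP.
  apply: le_trans (hl n) _; apply: le_trans hn.
  by have := d_le n; rewrite mul1r => h; rewrite ler_pM2l.
have [M hM] := qM l Wl.
pose n := Num.bound `|M|; have [_ _ [i [hi Ki]]] := hf (n, s n).
have hWx : W (sval (s n.+1).1) by exact: svalP.
have h1 : q i (sval (s n.+1).1) <= q i l + q i (l - sval (s n.+1).1).
  by rewrite -(qN i (l - _)) opprB; apply: le_trans (qD _ _ _); rewrite addrC subrK.
have h2 : q i (l - sval (s n.+1).1) <= 2.
  apply: le_trans (qK _ _ (WD _ _ Wl (WN _ hWx))) _.
  apply: (@le_trans _ _ (`|K i| * N (l - sval (s n.+1).1))).
    by rewrite ler_wpM2r ?ler_norm ?(cn_ge0 cN).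
  apply: (@le_trans _ _ (`|K i| * (2 * val (s n.+1).2))).
    by rewrite ler_wpM2l // hl.
  by rewrite mulrCA; move: Ki; rewrite /=; lra.
have h3 : M < n%:R.
  by apply: le_lt_trans (ler_norm _) (archi_boundP _).
have := hM i; have hi' : n%:R + 3 <= q i (sval (s n.+1).1) by [].
by move: h1 h2 h3 hi'; lra.
Qed.

End CompleteNorm.

(** * Banach algebras *)

Section RootsOfUnity.
Variable R : realType.

Lemma complex_prim_root_exists n :
  (0 < n)%N -> exists w : R[i], n.-primitive_root w.
Proof.
move=> n0; pose p : {poly R[i]} := 'X^n - 1.
have [r Dp] := closed_field_poly_normal p.
rewrite (monicP _) ?monicXnsubC // scale1r in Dp.
have rn1 : all n.-unity_root r by apply/allP=> z; rewrite -root_prod_XsubC -Dp.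
have sz_r : (n < (size r).+1)%N by rewrite -(size_prod_XsubC r id) -Dp size_XnsubC.
have [|z _ hz] := hasP (has_prim_root n0 rn1 _ sz_r); last by exists z.
by rewrite -separable_prod_XsubC -Dp separable_Xn_sub_1 // pnatr_eq0 -lt0n.
Qed.

Lemma cabs_prim_root n (w : R[i]) j : n.-primitive_root w -> cabs (w ^+ j) = 1.
Proof.
move=> pw; apply/eqP; rewrite -(@pexpr_eq1 _ _ n) ?cabs_ge0 //.
  by rewrite -cabsX exprAC (prim_expr_order pw) expr1n cabs1.
exact: prim_order_gt0 pw.
Qed.

Lemma sum_prim_root n (w : R[i]) k : n.-primitive_root w -> (k < n)%N ->
  \sum_(j < n) (w ^+ k) ^+ j = if k == 0%N then n%:R else 0.
Proof.
move=> pw kn; have [->|k0] := eqVneq k 0%N.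
  by rewrite expr0 (eq_bigr (fun=> 1)) ?sumr_const ?card_ord // => j _; rewrite expr1n.
have wk1 : w ^+ k - 1 != 0.
  rewrite subr_eq0 -(expr0 w) (eq_prim_root_expr pw) mod0n modn_small //.
apply: (mulfI wk1); rewrite -subrX1 exprAC (prim_expr_order pw) expr1n subrr.
by rewrite mulr0.
Qed.

End RootsOfUnity.

Lemma mul_geometric_sum (S : nzRingType) (x : S) n :
  (1 - x) * (\sum_(i < n) x ^+ i) = 1 - x ^+ n.
Proof. by rewrite -[LHS]opprK -mulNr opprB -subrX1 opprB. Qed.

Lemma geometric_sum_mul (S : nzRingType) (x : S) n :
  (\sum_(i < n) x ^+ i) * (1 - x) = 1 - x ^+ n.
Proof.
rewrite -mul_geometric_sum; apply/esym/commr_sum => i _.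
by apply: commrX; apply/commr_sym/commrB; [exact: commr1 | exact: commr_refl].
Qed.

Section BanachAlgebra.
Variables (R : realType) (U : algType R[i]) (N : U -> R).
Implicit Types (a b x y : U).

Definition inverse_of x y := x * y = 1 /\ y * x = 1.

Definition invertible x := exists y, inverse_of x y.

Record banach_norm : Prop := BanachNorm {
  bn_complete : complete_norm N;
  bn_mul : forall x y, N (x * y) <= N x * N y;
  bn_one : N 1 = 1
}.

Lemma inverse_unique x y y' : inverse_of x y -> inverse_of x y' -> y = y'.
Proof. by move=> [_ yx] [xy' _]; rewrite -[y]mulr1 -xy' mulrA yx mul1r. Qed.

Lemma inverse_sym x y : inverse_of x y -> inverse_of y x.
Proof. by case. Qed.

Lemma inverse_ofM x y x' y' :
  inverse_of x y -> inverse_of x' y' -> inverse_of (x * x') (y' * y).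
Proof.
move=> [xy yx] [xy' yx']; split.
  by rewrite mulrA -(mulrA x) xy' mulr1.
by rewrite mulrA -(mulrA y') yx mulr1.
Qed.

Lemma invertibleM x y : invertible x -> invertible y -> invertible (x * y).
Proof. by move=> [x' ?] [y' ?]; exists (y' * x'); exact: inverse_ofM. Qed.

Lemma invertible_mul_eq0 x y : invertible y -> x * y = 0 -> x = 0.
Proof. by move=> [z [yz _]] xy; rewrite -[x]mulr1 -yz mulrA xy mul0r. Qed.

Lemma one_sided_invertible x l r : l * x = 1 -> x * r = 1 -> invertible x.
Proof.
move=> lx xr; exists l; split => //.
have -> : l = r by rewrite -[l]mulr1 -xr mulrA lx mul1r.
by [].
Qed.

Hypothesis bN : banach_norm.
Let cN : complete_norm N := bn_complete bN.

Lemma bnX x n : N (x ^+ n) <= N x ^+ n.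
Proof.
elim: n => [|n IH]; first by rewrite !expr0 (bn_one bN).
rewrite !exprS; apply: le_trans (bn_mul bN _ _) _.
by rewrite ler_wpM2l // (cn_ge0 cN).
Qed.

Lemma bn_mul_le x y (s t : R) : N x <= s -> N y <= t -> N (x * y) <= s * t.
Proof.
move=> hx hy; apply: le_trans (bn_mul bN _ _) _.
by apply: ler_pM; rewrite ?(cn_ge0 cN).
Qed.

Lemma neumann x : N x <= 2^-1 -> exists y, inverse_of (1 - x) y /\ N (y - 1) <= 2 * N x.
Proof.
move=> hx; pose u n := \sum_(i < n) x ^+ i.
have Nx0 := cn_ge0 cN x.
have xn n : N (x ^+ n) <= 1 / 2 ^+ n.
  apply: le_trans (bnX _ _) _; rewrite mul1r -exprVn.
  by apply: lerXn2r => //; rewrite nnegrE ?invr_ge0.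
have [|l hl] := cn_complete cN (u := u) (D := 1).
  by move=> n; rewrite /u big_ord_recr /= addrAC subrr add0r.
have ul n : (1 - x) * u n = 1 - x ^+ n by exact: mul_geometric_sum.
have ur n : u n * (1 - x) = 1 - x ^+ n by exact: geometric_sum_mul.
have Nx1 : N (1 - x) <= 2.
  by have := cnB cN 1 x; rewrite (bn_one bN); lra.
have small : forall e : R, 0 < e -> exists n, 6 / 2 ^+ n <= e.
  by move=> e e0; have [n hn] := geom_small 6 e0; exists n.
have l_inv : inverse_of (1 - x) l.
  split; apply: (cn_limit_unique cN) => e e0; have [n hn] := small e e0.
    have -> : (1 - x) * l - 1 = (1 - x) * (l - u n) - x ^+ n.
      by rewrite mulrBr ul opprB addrA [RHS]addrAC addrK.
    apply: le_trans (cnB cN _ _) _.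
    have := bn_mul_le Nx1 (hl n); have := xn n.
    by move: hn; set t := _ ^+ n; rewrite -![_ / t]mulrC; lra.
  have -> : l * (1 - x) - 1 = (l - u n) * (1 - x) - x ^+ n.
    by rewrite mulrBl ur opprB addrA [RHS]addrAC addrK.
  apply: le_trans (cnB cN _ _) _.
  have := bn_mul_le (hl n) Nx1; have := xn n.
  by move: hn; set t := _ ^+ n; rewrite -![_ / t]mulrC; lra.
exists l; split => //.
have Nl : N l <= 2.
  by have := hl 0%N; rewrite /u big_ord0 subr0 expr0; lra.
case: l_inv => h _; have -> : l - 1 = x * l.
  by rewrite -h mulrBl mul1r opprB addrCA subrr addr0.
by rewrite mulrC; apply: le_trans (bn_mul_le (lexx _) Nl) _; rewrite mulrC.
Qed.

Lemma neumann_bound x y : N x <= 2^-1 -> inverse_of (1 - x) y -> N (y - 1) <= 2 * N x.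
Proof.
by move=> /neumann[z [iz hz]] iy; rewrite (inverse_unique iy iz).
Qed.

(** The geometric sum [s] satisfies [(1 - x) s = s (1 - x) = 1 - x^m], so an inverse of the right
    side gives both one-sided inverses. Spectral radius conditions are used in this form, through
    one small power. *)
Lemma power_small_invertible x m : N (x ^+ m) <= 2^-1 -> invertible (1 - x).
Proof.
move=> /neumann[v [[v1 v2] _]]; pose s := \sum_(i < m) x ^+ i.
have sl : (1 - x) * s = 1 - x ^+ m by exact: mul_geometric_sum.
have sr : s * (1 - x) = 1 - x ^+ m by exact: geometric_sum_mul.
apply: (@one_sided_invertible _ (v * s) (s * v)).
  by rewrite -mulrA sr.
by rewrite mulrA sl.
Qed.

Lemma lt1_invertible x : N x < 1 -> invertible (1 - x).
Proof.
move=> x1; have x0 := cn_ge0 cN x.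
have [m hm] : exists m, N x ^+ m <= 2^-1.
  have [->|xn0] := eqVneq (N x) 0; first by exists 1%N; rewrite expr1 invr_ge0.
  have xgt0 : 0 < N x by rewrite lt_neqAle eq_sym xn0.
  (* By Bernoulli, [(1 + t)^m >= 1 + m t], which is at least 2 once [m] exceeds [1 / t]. *)
  pose t := (N x)^-1 - 1.
  have t0 : 0 < t by rewrite subr_gt0 invf_gt1.
  pose m := Num.bound (1 / t); exists m.
  have bern k : 1 + k%:R * t <= (1 + t) ^+ k.
    elim: k => [|k IH]; first by rewrite mul0r addr0 expr0.
    rewrite exprS -natr1.
    have : 0 <= k%:R * t by rewrite mulr_ge0 // ltW.
    move: IH; set p := _ ^+ k; set q := k%:R * t => IH q0.
    have : (1 + t) * (1 + q) <= (1 + t) * p by rewrite ler_pM2l // addr_gt0.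
    have : 0 <= t * q by rewrite mulr_ge0 // ltW.
    by rewrite /q; nra.
  have hb : 1 / t < m%:R by rewrite archi_boundP // divr_ge0 // ltW.
  rewrite -[N x]invrK exprVn lef_pV2 ?posrE ?exprn_gt0 ?invr_gt0 //.
  have -> : (N x)^-1 = 1 + t by rewrite /t addrC subrK.
  apply: le_trans (bern m); move: hb; rewrite ltr_pdivrMr //; lra.
by apply: (@power_small_invertible _ m); apply: le_trans (bnX _ _) hm.
Qed.

Lemma invertible_perturb a b a' : inverse_of a b -> N (a - a') * N b <= 2^-1 ->
  exists b', inverse_of a' b' /\ N b' <= 2 * N b.
Proof.
move=> [ab ba] h; pose e := b * (a - a').
have he : N e <= 2^-1.
  by apply: le_trans (bn_mul bN _ _) _; rewrite mulrC.
have [v [iv hv]] := neumann he.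
have ae : a' = a * (1 - e).
  by rewrite mulrBr mulr1 /e mulrA ab mul1r opprB addrCA subrr addr0.
exists (v * b); split; first by rewrite ae; apply: inverse_ofM.
apply: bn_mul_le => //.
have := cn_triangle cN (v - 1) 1; rewrite subrK (bn_one bN); lra.
Qed.

Lemma inverse_dist a b a' b' : inverse_of a b -> inverse_of a' b' ->
  N (b - b') <= N b * N (a - a') * N b'.
Proof.
move=> [ab ba] [ab' ba'].
have -> : b - b' = - (b * (a - a') * b').
  by rewrite mulrBr ba mulrBl mul1r -mulrA ab' mulr1 opprB.
rewrite (cnN cN); apply: bn_mul_le => //; exact: bn_mul.
Qed.

End BanachAlgebra.

(** * A uniform spectral radius estimate from resolvent bounds *)

Section UniformSpectralRadius.
Variables (R : realType) (U : algType R[i]) (N : U -> R) (bN : banach_norm N).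
Let cN : complete_norm N := bn_complete bN.
Variables (I : Type) (x : I -> U) (B D : R).
Hypothesis xD : forall i, N (x i) <= D.
Hypothesis xB : forall i (m : R[i]), cabs m <= 1 ->
  exists y, inverse_of (1 - m *: x i) y /\ N y <= B.

Let resolvent_exists (im : I * R[i]) : exists y, cabs im.2 <= 1 ->
  inverse_of (1 - im.2 *: x im.1) y /\ N y <= B.
Proof.
case: im => i m /=; have [h|h] := lerP (cabs m) 1.
  by have [y ?] := xB i h; exists y.
by exists 0.
Qed.

(** A continuity argument in [t] from 0 to 1. The averaged resolvent [F] inverts [1 - (t x_i)^(n+1)]
    and is Lipschitz in [t] with a constant free of [n] and [i], so smallness of the powers
    propagates from [t = 0] in finitely many steps, uniformly in [i]. *)
Lemma uniform_power_decay :
  exists n0, forall n, (n0 <= n)%N -> forall i, N (x i ^+ n) <= 32%:R^-1.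
Proof.
have [y hy] := choice resolvent_exists.
have [w hw] := choice (fun n => @complex_prim_root_exists R n.+1 (ltn0Sn n)).
(* averaging the resolvent over the roots of unity gives the resolvent of a power *)
pose F n i (t : R) := n.+1%:R^-1%:C *: \sum_(j < n.+1) y (i, w n ^+ j * t%:C).
have cabs_wt n j (t : R) : 0 <= t <= 1 -> cabs (w n ^+ j * t%:C) <= 1.
  by move=> /andP[t0 t1]; rewrite cabsM (cabs_prim_root _ (hw n)) mul1r cabs_real ger0_norm.
have n1 n : (n.+1%:R^-1%:C : R[i]) * n.+1%:R = 1.
  by rewrite -(rmorph_nat (real_complex R)) -rmorphM mulVf ?rmorph1 // pnatr_eq0.
have Finv n i t : 0 <= t <= 1 -> inverse_of (1 - (t%:C *: x i) ^+ n.+1) (F n i t).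
  move=> t01; set z := t%:C *: x i.
  have term j : y (i, w n ^+ j * t%:C) * (1 - z ^+ n.+1) =
      \sum_(k < n.+1) (w n ^+ j) ^+ k *: z ^+ k /\
      (1 - z ^+ n.+1) * y (i, w n ^+ j * t%:C) =
      \sum_(k < n.+1) (w n ^+ j) ^+ k *: z ^+ k.
    have [/= [h1 h2] _] := hy (i, w n ^+ j * t%:C) (cabs_wt n j t t01).
    move: h1 h2; rewrite -scalerA -/z; set v := y _; set c := w n ^+ j => h1 h2.
    have cz : (c *: z) ^+ n.+1 = z ^+ n.+1.
      by rewrite exprZn /c exprAC (prim_expr_order (hw n)) expr1n scale1r.
    rewrite -cz; under eq_bigr do rewrite -exprZn.
    split; first by rewrite -mul_geometric_sum mulrA h2 mul1r.
    by rewrite -geometric_sum_mul -mulrA h1 mulr1.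
  have total : \sum_(j < n.+1) \sum_(k < n.+1) (w n ^+ j) ^+ k *: z ^+ k
             = n.+1%:R *: (1 : U).
    rewrite exchange_big /= (bigD1 ord0) //= [X in _ + X]big1 ?addr0.
      by under eq_bigr do rewrite !expr0 scale1r; rewrite sumr_const card_ord scaler_nat.
    move=> k k0; rewrite -scaler_suml.
    rewrite (eq_bigr (fun j : 'I_n.+1 => (w n ^+ k) ^+ j)) => [|j _]; last exact: exprAC.
    by rewrite (sum_prim_root (hw n)) // -[_ == 0%N]/(k == ord0) (negPf k0) scale0r.
  split.
    rewrite /F -scalerAr mulr_sumr; under eq_bigr do rewrite (term _).2.
    by rewrite total scalerA n1 scale1r.
  rewrite /F -scalerAl mulr_suml; under eq_bigr do rewrite (term _).1.
  by rewrite total scalerA n1 scale1r.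
pose L := `|B| * `|D| * `|B| + 1.
have L0 : 0 < L by rewrite ltr_wpDl // !mulr_ge0.
have Flip n i s t : 0 <= s <= 1 -> 0 <= t <= 1 -> N (F n i s - F n i t) <= L * `|s - t|.
  move=> s01 t01; rewrite /F -scalerBr -sumrB (cn_real cN) ger0_norm ?invr_ge0 //.
  rewrite mulrC ler_pdivrMr // [leRHS]mulrC.
  apply: le_trans (cn_sum cN _ _) _.
  rewrite mulr_natl -[X in _ *+ X](card_ord n.+1) -sumr_const; apply: ler_sum => j _.
  have [/= h1 B1] := hy (i, w n ^+ j * s%:C) (cabs_wt n j s s01).
  have [/= h2 B2] := hy (i, w n ^+ j * t%:C) (cabs_wt n j t t01).
  apply: le_trans (inverse_dist bN h1 h2) _.
  rewrite subrB_swap subrr sub0r opprB -scalerBl -mulrBr -rmorphB (cn_scale cN) cabsM.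
  rewrite (cabs_prim_root _ (hw n)) mul1r cabs_real distrC.
  apply: (@le_trans _ _ (`|B| * (`|s - t| * `|D|) * `|B|)).
    apply: ler_pM; rewrite ?mulr_ge0 ?(cn_ge0 cN) //.
      apply: ler_pM; rewrite ?mulr_ge0 ?(cn_ge0 cN) //.
        by apply: le_trans B1 (ler_norm _).
      by rewrite ler_wpM2l // (le_trans (xD i)) ?ler_norm.
    by apply: le_trans B2 (ler_norm _).
  by rewrite /L mulrDl mul1r; have := normr_ge0 (s - t); lra.
pose P (t : R) := exists n0, forall n, (n0 <= n)%N -> forall i,
  N ((t%:C *: x i) ^+ n) <= 32%:R^-1.
(* Powers at [s] below 1/32 put [F] within 1/16 of 1; the Lipschitz bound gives 5/64 at [t], and
   Neumann's series only 10/64 for the powers there. A product of two such powers is again below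
   1/32, at the price of doubling the threshold. *)
have step s t : 0 <= s <= 1 -> 0 <= t <= 1 -> L * `|s - t| <= 64%:R^-1 -> P s -> P t.
  move=> s01 t01 st [n0 h0]; exists (n0.+1 + n0.+1)%N => n hn i.
  have half k : (n0 < k)%N -> N ((t%:C *: x i) ^+ k) <= 10%:R / 64%:R.
    case: k => // k hk.
    have a0 := h0 k.+1 (leqW hk) i.
    have a1 : N (F k i s - 1) <= 16%:R^-1.
      have := neumann_bound bN _ (Finv k i s s01); lra.
    have a2 : N (1 - F k i t) <= 5%:R / 64%:R.
      rewrite (cnC cN); apply: le_trans (cn_dist cN (F k i s) _ _) _.
      by have := Flip k i t s t01 s01; rewrite distrC; lra.
    have iF : inverse_of (1 - (1 - F k i t)) (1 - (t%:C *: x i) ^+ k.+1).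
      by rewrite opprB addrC subrK; apply/inverse_sym/Finv.
    have := neumann_bound bN _ iF; rewrite addrAC subrr add0r (cnN cN); lra.
  rewrite -(subnK (leq_trans (leq_addl n0.+1 n0.+1) hn)) exprD.
  have h1 := half (n - n0.+1)%N; have h2 := half n0.+1 (ltnSn _).
  apply: le_trans (bn_mul_le bN (h1 _) h2) _; last by lra.
  by rewrite ltn_subRL (leq_trans _ hn) // addSn -addnS.
(* The mesh depends on [L] alone, so the threshold is doubled a fixed number of times. *)
have [K hK] : exists K : nat, L / K.+1%:R <= 64%:R^-1.
  exists (Num.bound (L * 64%:R)).
  have h : L * 64%:R < (Num.bound (L * 64%:R))%:R.
    by rewrite archi_boundP // mulr_ge0 // ltW.
  rewrite ler_pdivrMr // -[X in _ * X]natr1.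
  lra.
have Pk k : (k <= K.+1)%N -> P (k%:R / K.+1%:R).
  elim: k => [_|k IH hk].
    exists 1%N => n n0 i; rewrite mul0r rmorph0 scale0r expr0n.
    by rewrite eqn0Ngt n0 (cn0 cN) invr_ge0.
  have dv j : (j <= K.+1)%N -> 0 <= (j%:R / K.+1%:R : R) <= 1.
    by move=> hj; rewrite divr_ge0 //= ler_pdivrMr // mul1r ler_nat.
  apply: step (IH (ltnW hk)); [exact/dv/ltnW | exact: dv |].
  rewrite -mulrBl -natr1 opprD addrA subrr sub0r mulN1r normrN.
  by rewrite ger0_norm ?invr_ge0.
have [n0 h0] := Pk K.+1 (leqnn _); exists n0 => n hn i.
by have := h0 n hn i; rewrite divff ?pnatr_eq0 // scale1r.
Qed.

End UniformSpectralRadius.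

(** * Cauchy estimates for powers of a linear pencil *)

Section PencilPower.
Variables (R : realType) (U : algType R[i]) (N : U -> R) (bN : banach_norm N).
Let cN : complete_norm N := bn_complete bN.

Lemma pencil_power (b d : U) n : exists c : nat -> U,
  forall l : R[i], (l *: b + d) ^+ n = \sum_(k < n.+1) l ^+ k *: c k.
Proof.
elim: n => [|n [c hc]].
  by exists (fun=> 1) => l; rewrite big_ord1 !expr0 scale1r.
exists (fun k => (if k is k'.+1 then b * c k' else 0) +
                 (if (k < n.+1)%N then d * c k else 0)) => l.
rewrite exprS hc mulrDl !mulr_sumr.
under [RHS]eq_bigr do rewrite scalerDr.
rewrite big_split /=; congr (_ + _).
  rewrite [RHS]big_ord_recl scaler0 add0r; apply: eq_bigr => k _.
  by rewrite -scalerAl -scalerAr scalerA exprS.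
rewrite [RHS]big_ord_recr /= ltnn scaler0 addr0; apply: eq_bigr => k _.
by rewrite ltn_ord -scalerAr.
Qed.

(** Cauchy's estimate: the average over [n + 1] equally spaced points of the circle of radius [r]
    isolates a coefficient exactly, since the degree is at most [n]. *)
Lemma coefficient_bound n (c : nat -> U) (r M : R) : 0 <= r ->
  (forall l : R[i], cabs l <= r -> N (\sum_(k < n.+1) l ^+ k *: c k) <= M) ->
  forall k, (k <= n)%N -> r ^+ k * N (c k) <= M.
Proof.
move=> r0 h k kn; have [w pw] := @complex_prim_root_exists R n.+1 (ltn0Sn n).
(* The exponent [n.+1 - k] plays the role of [- k], as [w] has order [n.+1]. *)
pose S := \sum_(j < n.+1) (w ^+ (n.+1 - k)) ^+ j *:
            \sum_(m < n.+1) (r%:C * w ^+ j) ^+ m *: c m.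
have SE : S = n.+1%:R *: (r%:C ^+ k *: c k).
  rewrite /S; under eq_bigr do rewrite scaler_sumr.
  rewrite exchange_big /= (bigD1 (Ordinal (kn : (k < n.+1)%N))) //=.
  rewrite [X in _ + X]big1 ?addr0.
    rewrite (eq_bigr (fun=> r%:C ^+ k *: c k)) ?sumr_const ?card_ord ?scaler_nat //.
    move=> j _; rewrite scalerA exprMn mulrCA -!exprM mulnC -exprD -mulnDr.
    by rewrite subnK 1?leqW // mulnC exprM (prim_expr_order pw) expr1n mulr1.
  move=> m mk.
  have hw : \sum_(j < n.+1) (w ^+ (n.+1 - k + m)) ^+ j = 0.
    rewrite -(eq_bigr _ (fun j _ => congr1 (fun z => z ^+ _) (prim_expr_mod pw _))).
    rewrite (sum_prim_root pw) ?ltn_mod // ifN //.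
    have mn := ltn_ord m; case: (ltngtP m k) => [mlt|mgt|mE].
    - rewrite modn_small; first by rewrite addn_eq0 subn_eq0 leqNgt ltnS kn.
      by lia.
    - rewrite -(subnK (ltnW mgt)) addnCA subnK 1?leqW // modnDr modn_small.
        by rewrite -lt0n subn_gt0.
      by apply: leq_ltn_trans (leq_subr _ _) mn.
    - by case/eqP: mk; apply: val_inj.
  rewrite (eq_bigr (fun j : 'I_n.+1 => (w ^+ (n.+1 - k + m)) ^+ j *: (r%:C ^+ m *: c m))).
    by rewrite -scaler_suml hw scale0r.
  move=> j _; rewrite !scalerA exprMn -!exprM mulnDl exprD [(m * j)%N]mulnC.
  by congr (_ *: _); ring.
have NS : N S <= n.+1%:R * M.
  apply: le_trans (cn_sum cN _ _) _.
  rewrite mulr_natl -[X in _ *+ X](card_ord n.+1) -sumr_const.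
  apply: ler_sum => j _; rewrite (cn_scale cN) -exprM (cabs_prim_root _ pw) mul1r.
  apply: h; rewrite cabsM (cabs_prim_root _ pw) mulr1 cabs_real ger0_norm //.
move: NS; rewrite SE !(cn_scale cN) cabsX cabs_real (ger0_norm r0).
rewrite -(rmorph_nat (real_complex R)) cabs_real ger0_norm ?ler0n //.
by rewrite ler_pM2l // ltr0n.
Qed.

End PencilPower.

(** * Pencils and semi-inner products *)

Section PencilResolvent.
Variables (R : realType) (U : algType R[i]) (N : U -> R) (bN : banach_norm N).
Let cN : complete_norm N := bn_complete bN.

Let small (r : R) (l : R[i]) := (`|complex.Re l| <= r) && (`|complex.Im l| <= r).

Let cabs_small r l : small r l -> cabs l <= r + r.
Proof. by case/andP => hs ht; apply: le_trans (cabs_ReIm l) (lerD hs ht). Qed.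

Let small_cabs r l : cabs l <= r -> small r l.
Proof.
move=> h; rewrite /small.
by rewrite (le_trans (cabs_ge_Re l)) ?(le_trans (cabs_ge_Im l)).
Qed.

(** Inverses are locally bounded, and compactness makes the bound global. Compactness is that of
    boxes of real and imaginary parts: these contain the discs of radius [r] and 1 and lie in the
    discs of doubled radius, hence the factors 2 in the hypothesis. *)
Lemma pencil_resolvent_bound (b d : U) (r : R) : 0 <= r ->
  (forall l m : R[i], cabs l <= 2 * r -> cabs m <= 2 ->
     invertible (1 - m *: (l *: b + d))) ->
  exists B, forall l m : R[i], cabs l <= r -> cabs m <= 1 ->
    exists y, inverse_of (1 - m *: (l *: b + d)) y /\ N y <= B.
Proof.
move=> r0 hinv.
pose P (B : R) (t : (R * R) * (R * R)) :=
  small r (t.1.1 +i* t.1.2) -> small 1 (t.2.1 +i* t.2.2) ->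
  exists y, inverse_of (1 - (t.2.1 +i* t.2.2) *: ((t.1.1 +i* t.1.2) *: b + d)) y
            /\ N y <= B.
pose K : set ((R * R) * (R * R)) :=
  ((`[- r, r] `*` `[- r, r]) `*` (`[- 1, 1] `*` `[- 1, 1])).
have cK : compact K by do 2![apply: compact_setX]; exact: segment_compact.
suff [B hB] : exists B, (K `<=` P B).
  exists B => -[l1 l2] [m1 m2] /small_cabs hl /small_cabs hm.
  apply: (hB ((l1, l2), (m1, m2))) => //.
  move: hl hm; rewrite /small /= => /andP[h1 h2] /andP[h3 h4].
  by split; split; rewrite /= in_itv /= -ler_norml.
move: cK => /compact_near_coveringP/(_ R (pinfty_nbhs R) P _) cK.
apply: (@filter_ex _ (pinfty_nbhs R)); apply: cK => -[[l1 l2] [m1 m2]].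
rewrite /K /= !in_itv /= -!ler_norml => -[[h1 h2] [h3 h4]].
set l := l1 +i* l2; set m := m1 +i* m2.
have hl : cabs l <= r + r by apply: cabs_small; rewrite /small /= h1 h2.
have hm : cabs m <= 1 + 1 by apply: cabs_small; rewrite /small /= h3 h4.
have [||y iy] := hinv l m; [lra | lra |].
(* The first term pays for a change of [m], the second for a change of [l]. With radius [del] the
   perturbation times [N y] stays below 1/2, as [invertible_perturb] requires. *)
pose Q := 2 * (2 * r * N b + N d) + 4 * N b.
have [Nb0 Nd0 Ny0] : [/\ 0 <= N b, 0 <= N d & 0 <= N y] by split; exact: (cn_ge0 cN).
have Q0 : 0 <= Q by rewrite /Q; have := mulr_ge0 r0 Nb0; nra.
pose del := (2 * (Q * N y + 1))^-1.
have QN0 := mulr_ge0 Q0 Ny0.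
have del0 : 0 < del by rewrite invr_gt0; lra.
(* The bound [B] is the parameter tending to infinity: any [B] above [2 * N y] serves the whole
   ball, and compactness yields one [B] for the box. *)
exists (ball ((l1, l2), (m1, m2)) del, [set B | 2 * N y <= B]).
  split; first exact: nbhsx_ballx.
  by exists (2 * N y); split; [exact: num_real | move=> x /ltW].
case=> -[[l1' l2'] [m1' m2']] B [/= [[b1 b2] [b3 b4]] hB].
rewrite /P /=; set l' := l1' +i* l2'; set m' := m1' +i* m2' => sl sm.
have dl : cabs (l - l') <= del + del.
  by apply: cabs_small; rewrite /small /=; apply/andP; split; exact: ltW.
have dm : cabs (m - m') <= del + del.
  by apply: cabs_small; rewrite /small /=; apply/andP; split; exact: ltW.
have hl' := cabs_small sl.
have hd : N (1 - m *: (l *: b + d) - (1 - m' *: (l' *: b + d))) <= del * Q.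
  rewrite subrB_swap subrr sub0r (cnN cN).
  have -> : m *: (l *: b + d) - m' *: (l' *: b + d)
          = (m - m') *: (l' *: b + d) + m *: ((l - l') *: b).
    rewrite [in RHS]scalerBl [RHS]addrAC -scalerDr scalerBl.
    by rewrite [l' *: b + d + _]addrC addrA subrK.
  apply: le_trans (cn_triangle cN _ _) _; rewrite !(cn_scale cN).
  have e1 : N (l' *: b + d) <= 2 * r * N b + N d.
    apply: le_trans (cn_triangle cN _ _) _; rewrite (cn_scale cN).
    by rewrite lerD2r ler_wpM2r //; lra.
  have e2 : cabs (m - m') * N (l' *: b + d) <= (del + del) * (2 * r * N b + N d).
    by apply: ler_pM; rewrite ?cabs_ge0 ?(cn_ge0 cN).
  have e3 : cabs m * (cabs (l - l') * N b) <= 2 * ((del + del) * N b).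
    apply: ler_pM; rewrite ?mulr_ge0 ?cabs_ge0 //.
    by rewrite ler_wpM2r.
  by rewrite /Q; lra.
have [|y' [iy' hy']] := invertible_perturb bN (a' := 1 - m' *: (l' *: b + d)) iy.
  apply: le_trans (ler_wpM2r Ny0 hd) _.
  rewrite -mulrA /del mulrC ler_pdivrMr; [lra | lra].
by exists y'; split => //; apply: le_trans hy' hB.
Qed.

Lemma pencil_power_bounded (b d : U) (r : R) : 0 <= r ->
  (forall l m : R[i], cabs l <= 2 * r -> cabs m <= 2 ->
     invertible (1 - m *: (l *: b + d))) ->
  exists n0, forall n, (n0 <= n)%N -> forall l, cabs l <= r ->
    N ((l *: b + d) ^+ n) <= 1.
Proof.
move=> r0 /(pencil_resolvent_bound r0)[B hB].
have [||n0 h0] := @uniform_power_decay _ _ _ bN {l : R[i] | cabs l <= r}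
   (fun l => sval l *: b + d) B (r * N b + N d).
- case=> l hl /=; apply: le_trans (cn_triangle cN _ _) _.
  by rewrite (cn_scale cN) lerD2r ler_wpM2r // (cn_ge0 cN).
- by case=> l hl m hm /=; exact: hB.
exists n0 => n hn l hl; apply: le_trans (h0 n hn (exist _ l hl)) _.
by rewrite invf_le1 // ler1n.
Qed.

Lemma power_bounded (x : U) :
  (forall m : R[i], cabs m <= 2 -> invertible (1 - m *: x)) ->
  exists n0, forall n, (n0 <= n)%N -> N (x ^+ n) <= 1.
Proof.
move=> h; have [//| |n0 h0] := @pencil_power_bounded 0 x 0.
  by move=> l m _ hm; rewrite scaler0 add0r; exact: h.
exists n0 => n /h0/(_ 0); rewrite scaler0 add0r; apply.
by rewrite cabs0.
Qed.

End PencilResolvent.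

Lemma conj_complexE (R : realType) (z : R[i]) : Num.conj z = conjc z.
Proof. by []. Qed.

(** * Semi-inner products and Cauchy-Schwarz *)

Section SemiInnerProduct.
Variables (R : realType) (V : lmodType R[i]) (B : V -> V -> R[i]).

Record semi_inner_product : Prop := SemiInnerProduct {
  sip_linr : forall x y z a, B x (a *: y + z) = a * B x y + B x z;
  sip_linl : forall x y z a, B (a *: x + z) y = Num.conj a * B x y + B z y;
  sip_ge0 : forall x, 0 <= B x x
}.

Hypothesis sB : semi_inner_product.

Let BDr x y z : B x (y + z) = B x y + B x z.
Proof. by have := sip_linr sB x y z 1; rewrite scale1r mul1r. Qed.
Let BDl x y z : B (x + z) y = B x y + B z y.
Proof. by have := sip_linl sB x y z 1; rewrite scale1r conjC1 mul1r. Qed.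
Let B0r x : B x 0 = 0.
Proof. by apply: (addrI (B x 0)); rewrite -BDr !addr0. Qed.
Let B0l x : B 0 x = 0.
Proof. by apply: (addrI (B 0 x)); rewrite -BDl !addr0. Qed.
Let BZr x y a : B x (a *: y) = a * B x y.
Proof. by have := sip_linr sB x y 0 a; rewrite addr0 B0r addr0. Qed.
Let BZl x y a : B (a *: x) y = Num.conj a * B x y.
Proof. by have := sip_linl sB x y 0 a; rewrite addr0 B0l addr0. Qed.

Lemma sip_expand x y a : B (x + a *: y) (x + a *: y) =
  B x x + (a * B x y + Num.conj a * B y x) + a * Num.conj a * B y y.
Proof. by rewrite BDl !BDr BZr !BZl BZr; ring. Qed.

(** Hermitian symmetry is forced by positivity: [B (x + a y) (x + a y)] is real, and the cases
    [a = 1] and [a = 'i] determine both parts of [B y x]. *)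
Lemma sip_conj x y : B y x = Num.conj (B x y).
Proof.
have im a : complex.Im (a * B x y + Num.conj a * B y x) = 0.
  have := sip_ge0 sB (x + a *: y); rewrite sip_expand.
  have := sip_ge0 sB x; have := sip_ge0 sB y.
  have -> : a * Num.conj a = `|a| ^+ 2 by rewrite normCK.
  rewrite -cabsE -rmorphXn /=; move: (a * B x y + _) (B x x) (B y y) => [u v] [s1 t1] [s2 t2].
  by move=> /ger0_Im /= -> /ger0_Im /= -> /ger0_Im; simpc.
have := im 1; have := im 'i.
case: (B x y) (B y x) => [s t] [u v].
rewrite !conj_complexE.
simpc => /= h1 h2; congr (_ +i* _); lra.
Qed.

Lemma cauchy_schwarz x y :
  cabs (B x y) ^+ 2 <= complex.Re (B x x) * complex.Re (B y y).
Proof.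
set c := cabs (B x y) ^+ 2; set P := complex.Re (B x x); set Q := complex.Re (B y y).
have P0 : 0 <= P by have := sip_ge0 sB x; rewrite lecE => /andP[].
have Q0 : 0 <= Q by have := sip_ge0 sB y; rewrite lecE => /andP[].
have c0 : 0 <= c by exact: sqr_ge0.
have quad (t : R) : 0 <= P - 2 * t * c + t ^+ 2 * c * Q.
  have := sip_ge0 sB (x + (- t%:C * Num.conj (B x y)) *: y); rewrite sip_expand.
  rewrite (sip_conj x y) [Num.conj (- _ * _)]rmorphM /= conjCK [Num.conj (- _)]rmorphN /=.
  have -> : Num.conj (t%:C : R[i]) = t%:C by rewrite conj_complexE conjc_real.
  have hc : B x y * Num.conj (B x y) = c%:C.
    by rewrite -normCK -cabsE -rmorphXn.
  have -> : - t%:C * Num.conj (B x y) * B x y + - t%:C * B x y * Num.conj (B x y)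
     = - (2 * t)%:C * c%:C.
    by rewrite -hc rmorphM (rmorph_nat (real_complex R)); ring.
  have -> : - t%:C * Num.conj (B x y) * (- t%:C * B x y) = (t ^+ 2)%:C * c%:C.
    by rewrite -hc rmorphXn; ring.
  have -> : B x x = P%:C by rewrite /P RRe_real // ger0_real // sip_ge0.
  have -> : B y y = Q%:C by rewrite /Q RRe_real // ger0_real // sip_ge0.
  by rewrite -rmorphN -!rmorphM -!rmorphD ler0c mulNr.
(* The form may be degenerate. If [Q = 0] the quadratic is affine in [t], and a large [t] refutes
   [c > 0]; otherwise its minimum is at [Q^-1]. *)
have [Q00|Qn0] := eqVneq Q 0.
  rewrite Q00 mulr0; rewrite leNgt; apply/negP => cgt0.
  have := quad ((P + 1) / (2 * c)); rewrite Q00 mulr0 addr0.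
  have -> : 2 * ((P + 1) / (2 * c)) * c = P + 1 by field; lra.
  by lra.
have Qgt0 : 0 < Q by rewrite lt_neqAle eq_sym Qn0.
have := quad Q^-1.
have -> : P - 2 * Q^-1 * c + Q^-1 ^+ 2 * c * Q = P - c / Q by field; lra.
by rewrite subr_ge0 ler_pdivrMr.
Qed.

Definition sip_norm x : R := Num.sqrt (complex.Re (B x x)).

Lemma sip_norm_ge0 x : 0 <= sip_norm x.
Proof. exact: sqrtr_ge0. Qed.

Lemma sip_norm_sqr x : sip_norm x ^+ 2 = complex.Re (B x x).
Proof.
by rewrite sqr_sqrtr //; have := sip_ge0 sB x; rewrite lecE => /andP[].
Qed.

Lemma sip_normE x : B x x = (sip_norm x ^+ 2)%:C.
Proof. by rewrite sip_norm_sqr RRe_real // ger0_real // sip_ge0. Qed.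

Lemma sip_bound x y : cabs (B x y) <= sip_norm x * sip_norm y.
Proof.
rewrite -(@ler_pXn2r _ 2) ?nnegrE ?cabs_ge0 ?mulr_ge0 ?sip_norm_ge0 //.
by rewrite exprMn !sip_norm_sqr cauchy_schwarz.
Qed.

Lemma sip_normZ a x : sip_norm (a *: x) = cabs a * sip_norm x.
Proof.
apply: (@pexpIrn _ 2); rewrite ?nnegrE ?mulr_ge0 ?cabs_ge0 ?sip_norm_ge0 //.
apply: complexI; rewrite -sip_normE BZr BZl mulrA -normCK -cabsE.
by rewrite sip_normE -rmorphXn -rmorphM exprMn.
Qed.

Lemma sip_normD x y : sip_norm (x + y) <= sip_norm x + sip_norm y.
Proof.
rewrite -(@ler_pXn2r _ 2) ?nnegrE ?addr_ge0 ?sip_norm_ge0 //.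
have := sip_expand x y 1; rewrite scale1r conjC1 !mul1r (sip_conj x y) => /(congr1 (@complex.Re R)).
rewrite sip_norm_sqr => ->; rewrite !raddfD /= -!sip_norm_sqr.
have := sip_bound x y; have := cabs_Re (B x y).
have -> : complex.Re (Num.conj (B x y)) = complex.Re (B x y).
  by rewrite conj_complexE; case: (B x y).
set p := sip_norm x; set q := sip_norm y; nra.
Qed.

End SemiInnerProduct.

(** * Ford's square root *)

Section StarAlgebra.
Variables (R : realType) (U : algType R[i]) (N : U -> R) (st : U -> U).
Implicit Types (a b h k u v x y : U).

Record involution : Prop := Involution {
  invoD : forall x y, st (x + y) = st x + st y;
  invoZ : forall (a : R[i]) x, st (a *: x) = Num.conj a *: st x;
  invoM : forall x y, st (x * y) = st y * st x;
  invoK : forall x, st (st x) = x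
}.

Hypothesis bN : banach_norm N.
Hypothesis iS : involution.
Let cN : complete_norm N := bn_complete bN.

Lemma invo1 : st 1 = 1.
Proof. by have := invoM iS (st 1) 1; rewrite !mulr1 (invoK iS) mulr1. Qed.

Lemma invoN x : st (- x) = - st x.
Proof. by rewrite -scaleN1r (invoZ iS) rmorphN rmorph1 scaleN1r. Qed.

Lemma invoB x y : st (x - y) = st x - st y.
Proof. by rewrite (invoD iS) invoN. Qed.

Lemma invo0 : st 0 = 0.
Proof. by have := invoB 0 0; rewrite !subrr. Qed.

Lemma invoX x n : st (x ^+ n) = st x ^+ n.
Proof.
elim: n => [|n IH]; first by rewrite !expr0 invo1.
by rewrite exprS (invoM iS) IH -exprSr.
Qed.

Lemma invertible_star x : invertible x -> invertible (st x).
Proof.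
move=> [y [xy yx]]; exists (st y).
by split; rewrite -(invoM iS) ?xy ?yx invo1.
Qed.

(* The involution preserves invertibility, so the spectral radius of [l b + d]
   is controlled by the norm of its adjoint. *)
Lemma star_pencil_bound b d (r M : R) : 0 <= r ->
  2 * (2 * r * N (st b) + N (st d)) < M ->
  exists n0, forall n, (n0 <= n)%N -> forall l, cabs l <= r ->
    N ((l *: b + d) ^+ n) <= M ^+ n.
Proof.
move=> r0 hM.
have Nb0 : 0 <= N (st b) by exact: (cn_ge0 cN).
have Nd0 : 0 <= N (st d) by exact: (cn_ge0 cN).
have M0 : 0 < M.
  apply: le_lt_trans hM; have := mulr_ge0 r0 Nb0; nra.
have [//| |n0 h0] := @pencil_power_bounded _ _ _ bN (M^-1%:C *: b) (M^-1%:C *: d) r.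
  move=> l m hl hm; set z := m *: _.
  rewrite -(invoK iS (1 - z)); apply: invertible_star.
  rewrite invoB invo1; apply: (lt1_invertible bN).
  have -> : st z = (M^-1%:C * Num.conj m) *: (Num.conj l *: st b + st d).
    rewrite /z [l *: _]scalerA [l * _]mulrC -[(_ * l) *: b]scalerA -scalerDr scalerA
      (invoZ iS) (invoD iS) (invoZ iS) rmorphM /=.
    by rewrite [Num.conj (_%:C)]conj_complexE conjc_real mulrC.
  rewrite (cn_scale cN) cabsM cabs_conj cabs_real gtr0_norm ?invr_gt0 //.
  rewrite -mulrA mulrC ltr_pdivrMr // mul1r; apply: le_lt_trans hM.
  apply: ler_pM; rewrite ?cabs_ge0 ?(cn_ge0 cN) //.
  apply: le_trans (cn_triangle cN _ _) _; rewrite (cn_scale cN) cabs_conj.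
  by rewrite lerD2r ler_wpM2r.
exists n0 => n hn l hl.
have -> : l *: b + d = M%:C *: (l *: (M^-1%:C *: b) + M^-1%:C *: d).
  rewrite scalerDr !scalerA mulrAC -!rmorphM divff ?gt_eqF // rmorph1.
  by rewrite mul1r scale1r.
rewrite exprZn (cn_scale cN) cabsX cabs_real gtr0_norm //.
by rewrite -[leRHS]mulr1 ler_wpM2l ?exprn_ge0 ?(ltW M0) // h0.
Qed.

Section FordSquareRoot.
Variable h : U.
Hypothesis hh : st h = h.
Hypothesis Nh : N h <= 4%:R^-1.

Let k_ n := iter n (fun k => (2^-1 : R)%:C *: (h + k * k)) 0.

Let k_S n : k_ n.+1 = (2^-1 : R)%:C *: (h + k_ n * k_ n).
Proof. by []. Qed.

Let Nk n : N (k_ n) <= 4%:R^-1.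
Proof.
elim: n => [|n IH]; first by rewrite (cn0 cN) invr_ge0.
rewrite k_S (cn_real cN) ger0_norm ?invr_ge0 //.
have := cn_triangle cN h (k_ n * k_ n); have := bn_mul_le bN IH IH; move: Nh; lra.
Qed.

Let comm_k v n : v * h = h * v -> v * k_ n = k_ n * v.
Proof.
move=> vh; elim: n => [|n IH]; first by rewrite mulr0 mul0r.
rewrite k_S -scalerAr -scalerAl mulrDr mulrDl vh; congr (_ *: (_ + _)).
by rewrite mulrA IH -mulrA IH mulrA.
Qed.

(** The map [k |-> (h + k^2) / 2] contracts the ball of radius 1/4, and its fixed point satisfies
    [(1 - k)^2 = 1 - h]. Commutation passes to the norm limit, whereas hermiticity of the iterates
    might not. *)
Lemma small_sqrt_exists : exists k,
  [/\ 2 *: k - k * k = h, N k <= 4%:R^-1 & forall v, v * h = h * v -> v * k = k * v].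
Proof.
have half2 : (2^-1 : R)%:C * 2 = 1.
  by rewrite -(rmorph_nat (real_complex R)) -rmorphM mulVf ?rmorph1 // pnatr_eq0.
have [|k hk] := cn_complete cN (u := k_) (D := 1).
  elim=> [|n IH].
    rewrite expr0 divr1 subr0; by apply: le_trans (Nk 1) _; rewrite invf_le1 ?ler1n.
  have -> : k_ n.+2 - k_ n.+1 =
     (2^-1 : R)%:C *: (k_ n.+1 * (k_ n.+1 - k_ n) + (k_ n.+1 - k_ n) * k_ n).
    rewrite [k_ n.+2]k_S [in X in _ - X = _]k_S -scalerBr; congr (_ *: _).
    by rewrite mulrBr mulrBl addrA subrK opprD addrACA subrr add0r.
  rewrite (cn_real cN) ger0_norm ?invr_ge0 //.
  have h1 := bn_mul_le bN (Nk n.+1) IH; have h2 := bn_mul_le bN IH (Nk n).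
  have := cn_triangle cN (k_ n.+1 * (k_ n.+1 - k_ n)) ((k_ n.+1 - k_ n) * k_ n).
  rewrite exprS invfM mul1r; move: h1 h2; rewrite !mul1r.
  have : 0 <= (2 ^+ n)^-1 :> R by rewrite invr_ge0 exprn_ge0.
  by set t := (2 ^+ n)^-1; lra.
have conv e : 0 < e -> exists n, N (k - k_ n) <= e /\ N (k - k_ n.+1) <= e.
  move=> e0; have [n hn] := geom_small (1 * 2) e0; exists n.
  split; first exact: le_trans (hk n) hn.
  apply: le_trans (hk n.+1) (le_trans _ hn).
  rewrite ler_wpM2l ?mul1r // lef_pV2 ?posrE ?exprn_gt0 //.
  by rewrite ler_eXn2l ?ltrDl.
have Nk1 : N k <= 4%:R^-1.
  apply: le_of_forall_eps => e /conv[n [hn _]].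
  have := cn_triangle cN (k - k_ n) (k_ n); rewrite subrK; have := Nk n; lra.
exists k; split => //.
  have kE : k = (2^-1 : R)%:C *: (h + k * k).
    apply: (cn_limit_unique cN) => e e0.
    have [|n [h1 h2]] := conv (e / 2); first by rewrite divr_gt0.
    have -> : k - (2^-1 : R)%:C *: (h + k * k) = (k - k_ n.+1) -
       (2^-1 : R)%:C *: (k * (k - k_ n) + (k - k_ n) * k_ n).
      rewrite mulrBr mulrBl addrA subrK -[RHS]addrA; congr (_ + _).
      rewrite k_S -opprD -scalerDr; congr (- (_ *: _)).
      by rewrite -[RHS]addrA; congr (_ + _); rewrite addrC subrK.
    apply: le_trans (cnB cN _ _) _; rewrite (cn_real cN) ger0_norm ?invr_ge0 //.
    have := cn_triangle cN (k * (k - k_ n)) ((k - k_ n) * k_ n).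
    have := bn_mul_le bN Nk1 h1; have := bn_mul_le bN h1 (Nk n).
    lra.
  by rewrite {1}kE scalerA mulrC half2 scale1r addrK.
move=> v vh; apply: (cn_limit_unique cN) => e e0.
have Nv := cn_ge0 cN v.
have [|n [hn _]] := conv (e / (2 * (N v + 1))).
  by rewrite divr_gt0 // mulr_gt0 // ltr_wpDl.
have -> : v * k - k * v = v * (k - k_ n) - (k - k_ n) * v.
  by rewrite mulrBr mulrBl (comm_k n vh) subrB_swap subrr subr0.
apply: le_trans (cnB cN _ _) _.
have := bn_mul_le bN (lexx (N v)) hn; have := bn_mul_le bN hn (lexx (N v)).
have -> : N v * (e / (2 * (N v + 1))) = e / 2 - e / (2 * (N v + 1)).
  by field; rewrite gt_eqF // ltr_wpDl.
have : 0 <= e / (2 * (N v + 1)) by rewrite divr_ge0 ?ltW // mulr_gt0 // ltr_wpDl.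
have -> : e / (2 * (N v + 1)) * N v = e / 2 - e / (2 * (N v + 1)).
  by field; rewrite gt_eqF // ltr_wpDl.
lra.
Qed.

(* Ford: [k] and its adjoint are commuting square roots of [1 - h] in the sense
   [(1 - k)^2 = 1 - h], and [2 - k - k^*] is invertible since both have spectral
   radius at most 1/4; so [k = k^*] without continuity of the involution. *)
Lemma ford_sqrt : exists k, st k = k /\ (1 - k) * (1 - k) = 1 - h.
Proof.
have [k [kh Nk1 kcomm]] := small_sqrt_exists.
have skh : 2 *: st k - st k * st k = h.
  have conj2 : Num.conj 2 = 2 :> R[i] by rewrite rmorph_nat.
  by rewrite -[RHS]hh -[in RHS]kh invoB (invoZ iS) (invoM iS) conj2.
have hk : k * h = h * k.
  by rewrite -kh mulrBr mulrBl -scalerAr -scalerAl mulrA.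
have skk : st k * k = k * st k.
  apply: kcomm; have := congr1 st hk.
  by rewrite !(invoM iS) hh.
have half2 : (2^-1 : R)%:C * 2 = 1.
  by rewrite -(rmorph_nat (real_complex R)) -rmorphM mulVf ?rmorph1 // pnatr_eq0.
have cast2V : (2^-1 : R)%:C = 2^-1.
  by rewrite fmorphV rmorph_nat.
have inv2 : inverse_of (2 *: (1 : U)) (2^-1 *: 1).
  by split; rewrite -scalerAl mul1r scalerA ?divff ?mulVf ?scale1r // pnatr_eq0.
have [y [iy hy]] : exists y, inverse_of (2 *: 1 - k) y /\ N y <= 2 / 3%:R.
  have [|v [iv hv]] := neumann bN (x := (2^-1 : R)%:C *: k).
    by rewrite (cn_real cN) ger0_norm ?invr_ge0 //; lra.
  exists (v * (2^-1 *: 1)); split.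
    have -> : 2 *: 1 - k = 2 *: 1 * (1 - (2^-1 : R)%:C *: k).
      by rewrite -scalerAl mul1r scalerBr scalerA mulrC half2 scale1r.
    exact: inverse_ofM.
  rewrite -scalerAr mulr1 -cast2V (cn_real cN) ger0_norm ?invr_ge0 //.
  have := cn_triangle cN (v - 1) 1; rewrite subrK (bn_one bN).
  move: hv; rewrite (cn_real cN) ger0_norm ?invr_ge0 //; lra.
(* The norm of [st k] is unknown, but its adjoint [k] has norm at most 1/4. The constant 2/3 exceeds
   twice 1/4, also bounds [N y], and has square below 1/2. *)
have [n0 hn0] : exists n0, forall n, (n0 <= n)%N -> N (st k ^+ n) <= (2 / 3%:R) ^+ n.
  have [//||n0 hn0] := @star_pencil_bound 0 (st k) 0 (2 / 3%:R).
    by rewrite mulr0 mul0r add0r (invoK iS); lra.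
  exists n0 => n /hn0/(_ 0); rewrite scaler0 add0r; apply.
  by rewrite cabs0.
have inv : invertible (2 *: 1 - k - st k).
  have [yl yr] := iy.
  have -> : 2 *: 1 - k - st k = (2 *: 1 - k) * (1 - y * st k).
    by rewrite mulrBr mulr1 mulrA yl mul1r.
  apply: invertibleM; first by exists y.
  have cky : GRing.comm y (st k).
    have c2 : st k * (2 *: 1 - k) = (2 *: 1 - k) * st k.
      by rewrite mulrBr mulrBl skk -scalerAr -scalerAl mulr1 mul1r.
    rewrite /GRing.comm -[RHS]mul1r -yr -mulrA [_ * (st k * y)]mulrA -c2.
    by rewrite -!mulrA yl mulr1.
  apply: (@power_small_invertible _ _ _ bN _ n0.+1).
  rewrite exprMn_comm //.
  have h1 := hn0 n0.+1 (leqnSn _).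
  have h2 : N (y ^+ n0.+1) <= (2 / 3%:R) ^+ n0.+1.
    apply: le_trans (bnX bN _ _) _; apply: lerXn2r => //.
      by rewrite nnegrE (cn_ge0 cN).
    by rewrite nnegrE divr_ge0.
  apply: le_trans (bn_mul_le bN h2 h1) _; rewrite -exprMn.
  have p01 : 0 <= (2 / 3%:R * (2 / 3%:R) : R) <= 1 by apply/andP; split; lra.
  rewrite exprS; have : (2 / 3%:R * (2 / 3%:R) : R) ^+ n0 <= 1.
    by case/andP: p01 => ? ?; exact: exprn_ile1.
  lra.
exists k; split.
  (* As [k] and [st k] commute, [(st k - k)(2 - k - st k)] is the difference of [2 k - k^2] and its
     adjoint version, both equal to [h]. *)
  apply/eqP; rewrite -subr_eq0; apply/eqP/(invertible_mul_eq0 inv).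
  rewrite -addrA -opprD mulrBr -scalerAr mulr1 mulrDr !mulrBl skk.
  rewrite [k * st k - _ + _]addrC addrA subrK scalerBr subrB_swap skh kh.
  exact: subrr.
rewrite mulrBr mulr1 mulrBl mul1r -kh (scaler_nat 2 k) mulr2n.
by rewrite -addrA -opprD addrA.
Qed.

End FordSquareRoot.
End StarAlgebra.

(** * The separating space of the involution *)

Section SeparatingSpace.
Variables (R : realType) (U : algType R[i]) (N : U -> R) (st : U -> U).
Hypothesis bN : banach_norm N.
Hypothesis iS : involution st.
Let cN : complete_norm N := bn_complete bN.
Implicit Types (a b h u v x y : U).

(** The vertical part of the closure of the graph of [st], the usual measure of discontinuity in
    closed graph arguments. *)
Definition separating a :=
  forall e : R, 0 < e -> exists x, N x <= e /\ N (st x - a) <= e.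

(* Johnson-Ransford: with [b = x^*] and [d = a - x^*], the coefficients of
   [(l b + d)^n] are bounded through the adjoint on [|l| <= r] and through the
   norm on [|l| <= 1/r], and [l = 1] lies in between. *)
Lemma separating_quasinilpotent a : separating a ->
  forall eta : R, 0 < eta -> exists n0, forall n, (n0 <= n)%N -> N (a ^+ n) <= eta ^+ n.
Proof.
move=> Sa eta eta0.
have Na := cn_ge0 cN a; have Nsa := cn_ge0 cN (st a).
pose M := 2 * N (st a) + 3%:R; have M0 : 0 < M by rewrite /M; lra.
(* Multiplying the two Cauchy estimates cancels [r^k] and leaves [N (c k)^2 <= (M (N a + 2) / r)^n];
   this [r] makes the base at most [(eta / 2)^2]. *)
pose r := M * (N a + 2) * 4%:R / eta ^+ 2 + 1.
have eta2 : 0 < eta ^+ 2 by rewrite exprn_gt0.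
have Q0 : 0 <= M * (N a + 2) * 4%:R / eta ^+ 2.
  by rewrite divr_ge0 ?(ltW eta2) // !mulr_ge0 ?(ltW M0) //; lra.
have r1 : 1 <= r by rewrite /r; lra.
have r0 : 0 < r by lra.
pose eps := (4%:R * r)^-1.
have eps0 : 0 < eps by rewrite invr_gt0 mulr_gt0.
have epsr : eps * r = 4%:R^-1 by rewrite /eps; field; rewrite gt_eqF.
have eps1 : eps <= 1 by rewrite /eps invf_le1 ?mulr_gt0 //; lra.
have [x [hx hxa]] := Sa eps eps0.
pose b := st x; pose d := a - b.
have Nd : N d <= eps by rewrite /d (cnC cN).
have Nb : N b <= N a + 1.
  by have := cn_triangle cN (b - a) a; rewrite subrK; lra.
have [||n0 hn0] := @star_pencil_bound _ _ _ _ bN iS b d r M; first exact: ltW.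
  have Nsb : N (st b) <= eps by rewrite /b (invoK iS).
  have Nsd : N (st d) <= N (st a) + eps.
    by rewrite /d (invoB iS); apply: le_trans (cnB cN _ _) _; lra.
  have : r * N (st b) <= 4%:R^-1.
    by rewrite -epsr mulrC ler_wpM2r // ltW.
  have : eps <= 4%:R^-1.
    by rewrite -epsr ler_peMr // ltW.
  by rewrite /M; nra.
exists n0 => n hn; have [c hc] := pencil_power b d n.
have ck k : (k <= n)%N -> N (c k) <= (eta / 2) ^+ n.
  move=> kn; have Nck := cn_ge0 cN (c k).
  have h1 : r ^+ k * N (c k) <= M ^+ n.
    apply: (coefficient_bound bN (n := n)) => //; first exact: ltW.
    by move=> l hl; rewrite -hc; exact: hn0.
  have h2 : r^-1 ^+ k * N (c k) <= ((N a + 2) / r) ^+ n.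
    apply: (coefficient_bound bN (n := n)) => //; first by rewrite invr_ge0 ltW.
    move=> l hl; rewrite -hc; apply: le_trans (bnX bN _ _) _.
    have h0 : N (l *: b + d) <= (N a + 2) / r.
      apply: le_trans (cn_triangle cN _ _) _; rewrite (cn_scale cN).
      have : cabs l * N b <= r^-1 * (N a + 1).
        by apply: ler_pM; rewrite ?cabs_ge0 ?(cn_ge0 cN).
      have : eps <= r^-1.
        by rewrite /eps lef_pV2 ?posrE ?mulr_gt0 //; lra.
      lra.
    apply: lerXn2r => //; rewrite nnegrE ?(cn_ge0 cN) // divr_ge0 ?(ltW r0) //.
    lra.
  have : N (c k) ^+ 2 <= ((eta / 2) ^+ n) ^+ 2.
    have -> : N (c k) ^+ 2 = (r ^+ k * N (c k)) * (r^-1 ^+ k * N (c k)).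
      by rewrite mulrACA -exprMn divff ?gt_eqF // expr1n mul1r.
    have hr : M * ((N a + 2) / r) <= (eta / 2) ^+ 2.
      have : M * (N a + 2) * 4%:R / eta ^+ 2 <= r by rewrite /r lerDl.
      rewrite ler_pdivrMr // mulrA ler_pdivrMr // expr_div_n; lra.
    rewrite exprAC; apply: (@le_trans _ _ ((M * ((N a + 2) / r)) ^+ n)).
      rewrite exprMn; apply: ler_pM => //; apply: mulr_ge0 => //.
        by rewrite exprn_ge0 // ltW.
      by rewrite exprn_ge0 // invr_ge0 ltW.
    apply: lerXn2r => //; rewrite nnegrE ?sqr_ge0 //.
    by rewrite mulr_ge0 ?divr_ge0 ?(ltW M0) ?(ltW r0) //; lra.
  by rewrite ler_pXn2r // nnegrE exprn_ge0 // divr_ge0 // ltW.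
have -> : a = 1 *: b + d by rewrite scale1r /d addrC subrK.
rewrite hc; apply: le_trans (cn_sum cN _ _) _.
(* There are [n + 1 <= 2^n] coefficients, which is why each was bounded with [eta / 2]. *)
apply: (@le_trans _ _ (\sum_(k < n.+1) (eta / 2) ^+ n)).
  apply: ler_sum => k _; rewrite expr1n scale1r; apply: ck.
  by rewrite -ltnS.
rewrite sumr_const card_ord -[_ *+ n.+1]mulr_natr expr_div_n -mulrA.
rewrite -[leRHS]mulr1 ler_wpM2l ?exprn_ge0 ?(ltW eta0) //.
by rewrite mulrC ler_pdivrMr ?exprn_gt0 // mul1r -natrX ler_nat ltn_expl.
Qed.

Lemma separating_invertible a : separating a -> invertible (1 - a).
Proof.
move=> Sa; have h0 : 0 < (2^-1 : R) by rewrite invr_gt0.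
have [n0 hn0] := separating_quasinilpotent Sa h0.
apply: (@power_small_invertible _ _ _ bN _ n0.+1).
apply: le_trans (hn0 _ (leqnSn _)) _; rewrite exprS -[leRHS]mulr1.
by rewrite ler_pM2l // exprn_ile1 ?ltW // invf_lt1 // ltr1n.
Qed.

Lemma separatingB a b : separating a -> separating b -> separating (a - b).
Proof.
move=> Sa Sb e e0; have e2 : 0 < e / 2 by rewrite divr_gt0.
have [x [x1 x2]] := Sa _ e2; have [y [y1 y2]] := Sb _ e2.
exists (x - y); split; first by have := cnB cN x y; lra.
by rewrite (invoB iS) subrB_swap; have := cnB cN (st x - a) (st y - b); lra.
Qed.

Lemma separating0 : separating 0.
Proof. by move=> e /ltW e0; exists 0; rewrite (invo0 iS) subr0 (cn0 cN). Qed.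

Lemma separatingN a : separating a -> separating (- a).
Proof. by move=> /(separatingB separating0); rewrite sub0r. Qed.

Lemma separatingMl u a : separating a -> separating (u * a).
Proof.
move=> Sa e e0; have Nu := cn_ge0 cN u; have Nsu := cn_ge0 cN (st u).
pose D := N u + N (st u) + 1; have D0 : 0 < D by rewrite /D; lra.
have [|x [x1 x2]] := Sa (e / D); first by rewrite divr_gt0.
exists (x * st u); split.
  apply: le_trans (bn_mul_le bN x1 (lexx _)) _.
  by rewrite mulrAC ler_pdivrMr // ler_pM2l // /D; lra.
rewrite (invoM iS) (invoK iS) -mulrBr.
apply: le_trans (bn_mul_le bN (lexx _) x2) _.
by rewrite mulrCA -[leRHS]mulr1 ler_pM2l // ler_pdivrMr // mul1r /D; lra.
Qed.

Lemma separatingMr u a : separating a -> separating (a * u).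
Proof.
move=> Sa e e0; have Nu := cn_ge0 cN u; have Nsu := cn_ge0 cN (st u).
pose D := N u + N (st u) + 1; have D0 : 0 < D by rewrite /D; lra.
have [|x [x1 x2]] := Sa (e / D); first by rewrite divr_gt0.
exists (st u * x); split.
  apply: le_trans (bn_mul_le bN (lexx _) x1) _.
  by rewrite mulrCA -[leRHS]mulr1 ler_pM2l // ler_pdivrMr // mul1r /D; lra.
rewrite (invoM iS) (invoK iS) -mulrBl.
apply: le_trans (bn_mul_le bN x2 (lexx _)) _.
by rewrite mulrAC ler_pdivrMr // ler_pM2l // /D; lra.
Qed.

Lemma separatingZ (c : R[i]) a : separating a -> separating (c *: a).
Proof. by move=> /(separatingMl (c *: 1)); rewrite -scalerAl mul1r. Qed.

(** The relation [separating (y - st x)] is the closure of the graph of [st]. It is closed and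
    everywhere defined even when [st] is discontinuous, so bounded selection applies. *)
Lemma involution_bounded_mod_separating :
  exists C : R, 0 < C /\
    forall x, exists y, separating (y - st x) /\ N y <= C * N x.
Proof.
apply: (@bounded_selection _ _ _ _ _ cN cN (fun x y => separating (y - st x))).
- by move=> x y x' y' h h'; rewrite (invoB iS) subrB_swap; exact: separatingB.
- move=> t x y /(separatingZ t%:C).
  by rewrite (invoZ iS) conj_complexE conjc_real scalerBr.
- move=> x y h e e0; have e3 : 0 < e / 3%:R by rewrite divr_gt0.
  have [x' [y' [S' hx hy]]] := h _ e3; have [z [z1 z2]] := S' _ e3.
  exists (z + (x' - x)); split.
    by have := cn_triangle cN z (x' - x); rewrite (cnC cN x') ; lra.
  rewrite (invoD iS) (invoB iS).
  have -> : st z + (st x' - st x) - (y - st x) = (st z - (y' - st x')) - (y - y').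
    rewrite -addrA -[RHS]addrA; congr (_ + _).
    by rewrite !opprB !addrA !subrK.
  by have := cnB cN (st z - (y' - st x')) (y - y'); lra.
- by move=> x; exists (st x); rewrite subrr; exact: separating0.
Qed.

Variable g : {scalar U}.
Hypothesis gpos : forall u, 0 <= g (st u * u).

Let B x y := g (st x * y).

Let sB : semi_inner_product B.
Proof.
split; rewrite /B.
- by move=> x y z a; rewrite mulrDr -scalerAr linearP.
- by move=> x y z a; rewrite (invoD iS) (invoZ iS) mulrDl -scalerAl linearP.
- exact: gpos.
Qed.

Let G := complex.Re (g 1).

Let g1E : g 1 = G%:C.
Proof.
by have := gpos 1; rewrite (invo1 iS) mul1r => h; rewrite /G RRe_real // ger0_real.
Qed.

Let G0 : 0 <= G.
Proof. by have := gpos 1; rewrite (invo1 iS) mul1r g1E ler0c. Qed.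

Let gCS x : cabs (g x) ^+ 2 <= G * cabs (g (st x * x)).
Proof.
have := cauchy_schwarz sB 1 x; rewrite /B (invo1 iS) !mul1r -/G => h.
by apply: le_trans h _; rewrite ler_wpM2l // cabs_Re.
Qed.

Let hermitian_real h : st h = h -> cabs (g h) = `|complex.Re (g h)|.
Proof.
move=> hh; have := sip_conj sB 1 h; rewrite /B hh (invo1 iS) mul1r mulr1 conj_complexE.
case: (g h) => s t /= [] tt; have -> : t = 0 by lra.
by rewrite -[s +i* 0]/(s%:C) cabs_real.
Qed.

Let hermitian_bound0 h : st h = h -> N h <= 4%:R^-1 -> complex.Re (g h) <= G.
Proof.
move=> hh Nh; have [k [kk kE]] := ford_sqrt bN iS hh Nh.
have := gpos (1 - k); rewrite (invoB iS) (invo1 iS) kk kE linearB /= g1E.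
by rewrite lecE => /andP[_]; case: (g h) => s t /=; rewrite subr_ge0.
Qed.

(** The factor 4 is the range 1/4 of Ford's lemma: scaled to that norm, both [h] and [- h] satisfy
    [g <= g 1], because [1 - h] and [1 + h] are hermitian squares. *)
Lemma hermitian_bound h : st h = h -> cabs (g h) <= 4%:R * N h * G.
Proof.
move=> hh; have [->|/eqP h0] := eqVneq h 0.
  by rewrite linear0 cabs0 (cn0 cN) mulr0 mul0r.
have Nh : 0 < N h := cn_gt0 cN h0.
pose t := (4%:R * N h)^-1; have t0 : 0 < t by rewrite invr_gt0 mulr_gt0.
have bd (s : R) : `|s| = t -> s * complex.Re (g h) <= G.
  move=> st'; have := @hermitian_bound0 (s%:C *: h).
  rewrite (invoZ iS) hh conj_complexE conjc_real linearZ /=.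
  rewrite (cn_real cN) st' /t invfM divfK ?gt_eqF // => /(_ erefl (lexx _)).
  by case: (g h) => p q /=; rewrite mul0r subr0.
have b1 := bd t (gtr0_norm t0); have b2 := bd (- t) (etrans (normrN t) (gtr0_norm t0)).
have tE : 4%:R * N h = t^-1 by rewrite invrK.
rewrite hermitian_real // tE -[leLHS]mul1r -(mulVf (lt0r_neq0 t0)) -mulrA.
rewrite ler_pM2l ?invr_gt0 ?mulr_gt0 //.
by case: (lerP 0 (complex.Re (g h))) => [/ger0_norm|/ltr0_norm] ->; rewrite // mulrN -mulNr.
Qed.

(** Iterated Cauchy-Schwarz passes from [h] to [h^(2^m)]; the crude bound on this power loses only a
    factor 4, which taking [2^m]-th roots removes in the limit. *)
Lemma hermitian_spectral_bound h (rho : R) : st h = h -> 0 < rho ->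
  (exists n0, forall n, (n0 <= n)%N -> N (h ^+ n) <= rho ^+ n) ->
  cabs (g h) <= rho * G.
Proof.
move=> hh rho0 [n0 hn0]; have gh := cabs_ge0 (g h).
have [GE0|Gn0] := eqVneq G 0.
  have := gCS h; rewrite GE0 mul0r mulr0 => h2.
  have : cabs (g h) ^+ 2 == 0 by rewrite eq_le h2 sqr_ge0.
  by rewrite sqrf_eq0 => /eqP ->.
have Gp : 0 < G by rewrite lt_neqAle eq_sym Gn0.
have iter_cs m : cabs (g h) ^+ (2 ^ m) * G <= G ^+ (2 ^ m) * cabs (g (h ^+ (2 ^ m))).
  elim: m => [|m IH]; first by rewrite !expn0 !expr1 mulrC.
  have IH2 : (cabs (g h) ^+ (2 ^ m) * G) ^+ 2 <= (G ^+ (2 ^ m) * cabs (g (h ^+ (2 ^ m)))) ^+ 2.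
    by apply: lerXn2r => //; rewrite nnegrE mulr_ge0 ?exprn_ge0 ?cabs_ge0.
  have cs := gCS (h ^+ (2 ^ m)).
  rewrite (invoX iS) hh -exprD addnn -mul2n -expnS in cs.
  move: IH2; rewrite !exprMn -!exprM -expnSr => IH2.
  have : G ^+ (2 ^ m.+1) * cabs (g (h ^+ (2 ^ m))) ^+ 2
      <= G ^+ (2 ^ m.+1) * (G * cabs (g (h ^+ (2 ^ m.+1)))).
    by rewrite ler_wpM2l ?exprn_ge0.
  move=> /(le_trans IH2); rewrite expr2 mulrA [G ^+ _ * (G * _)]mulrCA [leRHS]mulrC.
  by rewrite ler_pM2r.
rewrite leNgt; apply/negP => hlt.
(* If the claim failed then [q > 1], yet [q^(2^m) <= 4] for all large [m], against Bernoulli. *)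
pose q := cabs (g h) / (rho * G).
have rG : 0 < rho * G by rewrite mulr_gt0.
have q1 : 1 < q by rewrite ltr_pdivlMr // mul1r.
have qb m : (n0 <= 2 ^ m)%N -> q ^+ (2 ^ m) <= 4%:R.
  move=> /hn0 hm; rewrite expr_div_n ler_pdivrMr ?exprn_gt0 //.
  rewrite -(ler_pM2r Gp); apply: le_trans (iter_cs m) _.
  have := hermitian_bound (etrans (invoX iS h (2 ^ m)) (congr1 (fun z => z ^+ _) hh)).
  move=> hb; apply: le_trans (ler_wpM2l (exprn_ge0 _ G0) hb) _.
  have -> : 4%:R * (rho * G) ^+ (2 ^ m) * G = G ^+ (2 ^ m) * (4%:R * rho ^+ (2 ^ m) * G).
    by rewrite exprMn; ring.
  by rewrite ler_wpM2l ?exprn_ge0 // ler_wpM2r // ler_wpM2l.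
have bern n : 1 + n%:R * (q - 1) <= q ^+ n.
  elim: n => [|n IH]; first by rewrite mul0r addr0 expr0.
  rewrite exprS -natr1.
  have t0 : 0 < q - 1 by rewrite subr_gt0.
  have nt0 : 0 <= n%:R * (q - 1) by rewrite mulr_ge0 // ltW.
  have : q * (1 + n%:R * (q - 1)) <= q * q ^+ n by rewrite ler_pM2l //; lra.
  move: (mulr_ge0 nt0 (ltW t0)); rewrite mulrDl; set z := n%:R * (q - 1).
  by nra.
pose m := (n0 + Num.bound (4%:R / (q - 1)))%N.
have m2 : (m < 2 ^ m)%N by exact: ltn_expl.
have h1 := qb m (leq_trans (leq_addr _ _) (ltnW m2)); have h2 := bern (2 ^ m)%N.
have h3 : 4%:R / (q - 1) < (2 ^ m)%:R.
  apply: lt_le_trans (archi_boundP _) _; first by rewrite divr_ge0 // subr_ge0 ltW.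
  by rewrite ler_nat (leq_trans (leq_addl n0 _)) // ltnW.
by move: h3; rewrite ltr_pdivrMr ?subr_gt0 //; lra.
Qed.

(** Replacing [st x] by a bounded [y] changes [h = st x * x] by an element of the separating ideal,
    which does not affect invertibility. The powers of [h] thus grow at a rate [O(N x ^+ 2)], and
    [|g x|^2 <= G |g h|] concludes. *)
Theorem positive_functional_bounded : exists C : R, 0 <= C /\ forall x, cabs (g x) <= C * N x.
Proof.
have [C0 [C00 hC]] := involution_bounded_mod_separating.
exists (2 * Num.sqrt C0 * G); split; first by rewrite !mulr_ge0 ?sqrtr_ge0.
move=> x; have [->|/eqP x0] := eqVneq x 0; first by rewrite linear0 cabs0 (cn0 cN) mulr0.
have Nx : 0 < N x := cn_gt0 cN x0.
have [y [Sy Ny]] := hC x.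
pose tau := C0 * N x ^+ 2; have tau0 : 0 < tau by rewrite mulr_gt0 ?exprn_gt0.
pose rho := 4%:R * tau; have rho0 : 0 < rho by rewrite mulr_gt0.
pose h := st x * x; have hh : st h = h by rewrite (invoM iS) (invoK iS).
have Nyx : N (y * x) <= tau.
  by apply: le_trans (bn_mul_le bN Ny (lexx _)) _; rewrite -mulrA -expr2.
have [|n0 hn0] := @power_bounded _ _ _ bN (rho^-1%:C *: h).
  move=> m hm; set c := m * rho^-1%:C.
  have Nc : N (c *: (y * x)) <= 2^-1.
    rewrite (cn_scale cN) cabsM cabs_real gtr0_norm ?invr_gt0 //.
    apply: (@le_trans _ _ (2 * rho^-1 * tau)).
      apply: ler_pM; rewrite ?mulr_ge0 ?cabs_ge0 ?(cn_ge0 cN) ?invr_ge0 ?(ltW rho0) //.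
      by rewrite ler_wpM2r // invr_ge0 ltW.
    have -> : 2 * rho^-1 * tau = 2^-1 by rewrite /rho; field; rewrite gt_eqF.
    by [].
  have [v [[v1 v2] _]] := neumann bN Nc.
  (* The first factor is inverted by Neumann's series, [rho = 4 tau] being chosen so that [|m| <= 2]
     gives norm at most 1/2; the second differs from 1 by an element of the separating ideal. *)
  have -> : 1 - m *: (rho^-1%:C *: h) =
      (1 - c *: (y * x)) * (1 - v * (c *: ((st x - y) * x))).
    rewrite mulrBr mulr1 mulrA v1 mul1r -addrA -opprD -scalerDr -mulrDl addrC.
    by rewrite scalerA [y + _]addrC subrK addrC.
  apply: invertibleM; first by exists v.
  apply: separating_invertible; apply: separatingMl; apply: separatingZ.
  by apply: separatingMr; rewrite -opprB; exact: separatingN.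
have hb : cabs (g h) <= rho * G.
  apply: hermitian_spectral_bound => //; exists n0 => n /hn0.
  rewrite exprZn (cn_scale cN) cabsX cabs_real gtr0_norm ?invr_gt0 //.
  by rewrite exprVn mulrC ler_pdivrMr ?exprn_gt0 // mul1r.
rewrite -(@ler_pXn2r _ 2) ?nnegrE ?cabs_ge0 ?mulr_ge0 ?sqrtr_ge0 ?(ltW Nx) //.
apply: le_trans (gCS x) _; rewrite -/h !exprMn sqr_sqrtr ?(ltW C00) //.
apply: le_trans (ler_wpM2l G0 hb) _; rewrite /rho /tau.
by rewrite le_eqVlt; apply/orP; left; apply/eqP; ring.
Qed.

End SeparatingSpace.

(** * Instances of complete norms *)

Section NormInstances.
Variable R : realType.

Lemma complete_norm_intro (V : lmodType R[i]) (N : V -> R) :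
  (forall x y, N (x + y) <= N x + N y) ->
  (forall a x, N (a *: x) = cabs a * N x) ->
  (forall x, N x = 0 -> x = 0) ->
  (forall (u : nat -> V) (D : R), (forall n, N (u n.+1 - u n) <= D / 2 ^+ n) ->
     exists l, forall e, 0 < e -> exists n0, forall n, (n0 <= n)%N -> N (l - u n) <= e) ->
  complete_norm N.
Proof.
move=> ND NZ N0 Nc; split=> // u D hu; have [l hl] := Nc u D hu.
have NN x : N (- x) = N x by rewrite -scaleN1r NZ cabsN cabs1 mul1r.
have tail n k : N (u (n + k)%N - u n) <= D * 2 / 2 ^+ n - D * 2 / 2 ^+ (n + k).
  elim: k => [|k IH].
    by rewrite addn0 !subrr -(scale0r (0 : V)) NZ cabs0 mul0r.
  rewrite addnS -(subrK (u (n + k)%N) (u _)) -addrA.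
  apply: le_trans (ND _ _) _; apply: le_trans (lerD (hu _) IH) _.
  have -> : D * 2 / 2 ^+ (n + k).+1 = D / 2 ^+ (n + k).
    by rewrite exprS invfM mulrA mulfK // pnatr_eq0.
  by rewrite [D * 2 / 2 ^+ (n + k)]mulrAC; lra.
exists l => n; apply: le_of_forall_eps => e /hl[n0 h0].
have D0 : 0 <= D.
  have := hu 0%N; rewrite expr0 divr1; apply: le_trans.
  have := ND (u 1%N - u 0%N) (- (u 1%N - u 0%N)); rewrite NN subrr.
  by rewrite -(scale0r (0 : V)) NZ cabs0 mul0r; lra.
have := h0 (n + n0)%N (leq_addl _ _); have := tail n n0.
have : 0 <= D * 2 / 2 ^+ (n + n0) by rewrite divr_ge0 ?mulr_ge0 ?exprn_ge0.
have := ND (l - u (n + n0)%N) (u (n + n0)%N - u n); rewrite addrA subrK.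
by lra.
Qed.

(** Stated over a general field to serve both modules over [R[i]] and the real components of complex
    numbers; the smallness hypothesis supplies the archimedean property, absent from
    [numFieldType]. *)
Lemma geometric_cvg (K : numFieldType) (V : completeNormedModType K) (u : nat -> V) (D : K) :
  (forall e : K, 0 < e -> exists n, D * 2 / 2 ^+ n <= e) ->
  (forall n, `|u n.+1 - u n| <= D / 2 ^+ n) ->
  exists l, forall e, 0 < e -> exists n0, forall n, (n0 <= n)%N -> `|l - u n| <= e.
Proof.
move=> small hu.
have D0 : 0 <= D by have := hu 0%N; rewrite expr0 divr1; apply: le_trans.
have tail n k : `|u (n + k)%N - u n| <= D * 2 / 2 ^+ n - D * 2 / 2 ^+ (n + k).
  elim: k => [|k IH]; first by rewrite addn0 !subrr normr0.
  rewrite addnS -(subrK (u (n + k)%N) (u _)) -addrA.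
  apply: le_trans (ler_normD _ _) _; apply: le_trans (lerD (hu _) IH) _.
  have -> : D * 2 / 2 ^+ (n + k).+1 = D / 2 ^+ (n + k).
    by rewrite exprS invfM mulrA mulfK // pnatr_eq0.
  rewrite addrCA lerD2l [D * 2 / _]mulrAC mulr_natr mulr2n opprD addrA subrr sub0r.
  exact: lexx.
have cu : cvg (u @ \oo).
  apply/cauchy_cvgP/cauchy_exP => e e0.
  have e2 : 0 < e / 2 by rewrite divr_gt0.
  have [n0 hn0] := small _ e2; exists (u n0); exists n0 => // n /= hn.
  rewrite -ball_normE /= distrC -(subnKC hn).
  apply: le_lt_trans (tail _ _) _; apply: (@le_lt_trans _ _ (e / 2)).
    apply: le_trans hn0; rewrite gerBl.
    by rewrite divr_ge0 ?mulr_ge0 ?exprn_ge0.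
  by rewrite ltr_pdivrMr // mulr_natr mulr2n ltrDl.
exists (lim (u @ \oo)) => e e0.
have /cvgrPdist_le/(_ e e0)[n0 _ h] := cu.
by exists n0 => n /h.
Qed.

Lemma complete_norm_normedMod (V : completeNormedModType R[i]) :
  complete_norm (fun x : V => complex.Re `|x|).
Proof.
have NE (x : V) : (complex.Re `|x|)%:C = `|x| by rewrite RRe_real ?normr_real.
apply: complete_norm_intro.
- by move=> x y; rewrite -lecR rmorphD /= !NE ler_normD.
- by move=> a x; apply: complexI; rewrite rmorphM /= !NE cabsE normrZ.
- by move=> x x0; apply/normr0_eq0; rewrite -NE x0.
move=> u D hu; have [||l hl] := @geometric_cvg _ V u D%:C.
- move=> e e0; have Ee : e = (complex.Re e)%:C by rewrite RRe_real // gtr0_real.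
  have [|n hn] := @geom_small R (D * 2) (complex.Re e).
    by rewrite -ltcR -Ee.
  exists n; rewrite Ee; move: hn; rewrite -lecR.
  by rewrite fmorph_div rmorphM rmorphXn /= !(rmorph_nat (real_complex R)).
- move=> n; have := hu n; rewrite -lecR NE.
  by rewrite fmorph_div rmorphXn /= (rmorph_nat (real_complex R)).
exists l => e e0; have [|n0 hn0] := hl e%:C; first by rewrite ltcR.
by exists n0 => n /hn0; rewrite -lecR NE.
Qed.

Lemma complete_norm_complex : complete_norm (@cabs R : R[i]^o -> R).
Proof.
apply: complete_norm_intro.
- exact: cabsD.
- exact: cabsM.
- exact: cabs_eq0.
move=> u D hu.
have small (e : R) : 0 < e -> exists n, D * 2 / 2 ^+ n <= e by exact: geom_small.
have [n|l1 h1] := @geometric_cvg R R (fun n => complex.Re (u n)) D small.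
  by have := hu n; apply: le_trans; have := cabs_ge_Re (u n.+1 - u n); rewrite raddfB.
have [n|l2 h2] := @geometric_cvg R R (fun n => complex.Im (u n)) D small.
  by have := hu n; apply: le_trans; have := cabs_ge_Im (u n.+1 - u n); rewrite raddfB.
exists (l1 +i* l2) => e e0; have e2 : 0 < e / 2 by rewrite divr_gt0.
have [n1 k1] := h1 _ e2; have [n2 k2] := h2 _ e2.
exists (n1 + n2)%N => n hn.
have := k1 n (leq_trans (leq_addr _ _) hn); have := k2 n (leq_trans (leq_addl _ _) hn).
have := cabs_ReIm ((l1 +i* l2 : R[i]^o) - u n); rewrite !raddfB /=.
lra.
Qed.

Lemma complete_norm_prod (V W : lmodType R[i]) (NV : V -> R) (NW : W -> R) :
  complete_norm NV -> complete_norm NW ->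
  complete_norm (fun p : V * W => NV p.1 + NW p.2).
Proof.
move=> cV cW; apply: complete_norm_intro.
- move=> x y /=; have := cn_triangle cV x.1 y.1; have := cn_triangle cW x.2 y.2; lra.
- by move=> a x /=; rewrite (cn_scale cV) (cn_scale cW) mulrDr.
- case=> x y /= h; have hx := cn_ge0 cV x; have hy := cn_ge0 cW y.
  have /(cn_eq0 cV) -> : NV x = 0 by lra.
  by have /(cn_eq0 cW) -> : NW y = 0 by lra.
move=> u D hu; have small (e : R) : 0 < e -> exists n, D * 2 / 2 ^+ n <= e by exact: geom_small.
have [n|l1 h1] := cn_complete cV (u := fun n => (u n).1) (D := D).
  by have := hu n; have := cn_ge0 cW (u n.+1 - u n).2; rewrite /=; lra.
have [n|l2 h2] := cn_complete cW (u := fun n => (u n).2) (D := D).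
  by have := hu n; have := cn_ge0 cV (u n.+1 - u n).1; rewrite /=; lra.
have D0 : 0 <= D.
  have := hu 0%N; rewrite expr0 divr1; apply: le_trans.
  by rewrite addr_ge0 ?(cn_ge0 cV) ?(cn_ge0 cW).
exists (l1, l2) => e e0; have [|n0 hn0] := small (e / 2); first by rewrite divr_gt0.
exists n0 => n hn /=.
have : D * 2 / 2 ^+ n <= D * 2 / 2 ^+ n0.
  rewrite ler_wpM2l ?mulr_ge0 // lef_pV2 ?posrE ?exprn_gt0 //.
  by rewrite ler_eXn2l ?ltrDl.
by have := h1 n; have := h2 n; lra.
Qed.

Lemma complete_norm_ffun (V : lmodType R[i]) (N : V -> R) m : complete_norm N ->
  complete_norm (fun c : {ffun 'I_m -> V} => \sum_i N (c i)).
Proof.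
move=> cN; apply: complete_norm_intro.
- move=> x y; rewrite -big_split; apply: ler_sum => i _.
  by rewrite ffunE (cn_triangle cN).
- move=> a x; rewrite mulr_sumr; apply: eq_bigr => i _.
  by rewrite ffunE (cn_scale cN).
- move=> x h; apply/ffunP => i; rewrite ffunE; apply: (cn_eq0 cN).
  have /psumr_eq0P/(_ _ i) : forall j, true -> 0 <= N (x j).
    by move=> j _; exact: (cn_ge0 cN).
  by apply.
move=> u D hu.
have coord i : exists l, forall n, N (l - u n i) <= D * 2 / 2 ^+ n.
  apply: (cn_complete cN) => n; apply: le_trans (hu n).
  rewrite (bigD1 i) //= !ffunE lerDl; apply: sumr_ge0 => j _.
  exact: (cn_ge0 cN).
have [l hl] := choice coord.
have D0 : 0 <= D.
  have := hu 0%N; rewrite expr0 divr1; apply: le_trans.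
  by apply: sumr_ge0 => i _; exact: (cn_ge0 cN).
exists [ffun i => l i] => e e0.
have [n0 hn0] := geom_small (m%:R * (D * 2)) e0.
exists n0 => n hn; apply: le_trans hn0.
rewrite -mulrA mulr_natl -[X in _ *+ X](card_ord m) -sumr_const.
apply: ler_sum => i _; rewrite !ffunE; apply: le_trans (hl i n) _.
rewrite ler_wpM2l ?mulr_ge0 // lef_pV2 ?posrE ?exprn_gt0 //.
by rewrite ler_eXn2l ?ltrDl.
Qed.

(* The open mapping theorem bounds the coordinates modulo the subspace. *)
Lemma bounded_of_finite_codim (V : lmodType R[i]) (N : V -> R) (cN : complete_norm N)
    (W : set V) (q : V -> R) (C : R) :
  W 0 -> (forall x y, W x -> W y -> W (x + y)) ->
  (forall (a : R[i]) x, W x -> W (a *: x)) ->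
  (forall x, (forall e : R, 0 < e -> exists y, W y /\ N (x - y) <= e) -> W x) ->
  finite_codim W ->
  (forall x y, q (x + y) <= q x + q y) ->
  (forall a x, q (a *: x) = cabs a * q x) ->
  (forall x, W x -> q x <= C * N x) ->
  exists C', forall x, q x <= C' * N x.
Proof.
move=> W0 WD WZ Wcl [m [e he]] qD qZ qC.
have WB x y : W x -> W y -> W (x - y).
  by move=> Wx Wy; apply: WD => //; rewrite -scaleN1r; exact: WZ.
have cF := complete_norm_ffun (V := R[i]^o) m complete_norm_complex.
pose s (c : {ffun 'I_m -> R[i]^o}) := \sum_i c i *: e i.
pose G x c := W (x - s c).
have sB c c' : s (c - c') = s c - s c'.
  by rewrite /s -sumrB; apply: eq_bigr => i _; rewrite !ffunE scalerBl.
have sZ a c : s (a *: c) = a *: s c.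
  by rewrite /s scaler_sumr; apply: eq_bigr => i _; rewrite !ffunE scalerA.
pose E := \sum_i N (e i).
have E0 : 0 <= E by apply: sumr_ge0 => i _; exact: (cn_ge0 cN).
have sN c : N (s c) <= (\sum_i cabs (c i)) * E.
  apply: le_trans (cn_sum cN _ _) _; rewrite mulr_suml; apply: ler_sum => i _.
  rewrite (cn_scale cN) ler_wpM2l ?cabs_ge0 // /E (bigD1 i) //= lerDl.
  by apply: sumr_ge0 => j _; exact: (cn_ge0 cN).
have [||||K [K0 hK]] := @bounded_selection _ _ _ _ _ cN cF G.
- by move=> x c x' c' h h'; rewrite /G sB subrB_swap; exact: WB.
- by move=> t x c h; rewrite /G sZ -scalerBr; exact: WZ.
- move=> x c h; apply: Wcl => eps eps0.
  have d0 : 0 < eps / (1 + E) by rewrite divr_gt0 // ltr_pwDl.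
  have [x' [c' [h1 h2 h3]]] := h _ d0; exists (x' - s c'); split => //.
  rewrite subrB_swap -sB; apply: le_trans (cnB cN _ _) _.
  apply: (@le_trans _ _ (eps / (1 + E) * (1 + E))); last first.
    by rewrite divfK // gt_eqF // ltr_pwDl.
  rewrite mulrDr mulr1; apply: lerD h2 _.
  by apply: le_trans (sN _) _; rewrite ler_wpM2r.
- move=> x; have [c hc] := he x; exists [ffun i => c i].
  by rewrite /G /s; under eq_bigr do rewrite ffunE.
have q0 x : 0 <= q x.
  have := qD x (- x); rewrite -scaleN1r qZ cabsN cabs1 mul1r scaleN1r subrr.
  by have := qZ 0 0; rewrite scale0r cabs0 mul0r => ->; lra.
pose Q := \sum_i q (e i).
have Q0 : 0 <= Q by apply: sumr_ge0.
have qs c : q (s c) <= (\sum_i cabs (c i)) * Q.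
  rewrite mulr_suml /s.
  apply: (@le_trans _ _ (\sum_i q (c i *: e i))).
    elim/big_ind2: _ => // [|x1 x2 y1 y2 h1 h2].
      by have := qZ 0 0; rewrite scale0r cabs0 mul0r => ->.
    exact: le_trans (qD _ _) (lerD h1 h2).
  apply: ler_sum => i _; rewrite qZ ler_wpM2l ?cabs_ge0 // /Q (bigD1 i) //= lerDl.
  exact: sumr_ge0.
exists (`|C| * (1 + K * E) + K * Q) => x; have [c [Gc hc]] := hK x.
have Nx := cn_ge0 cN x.
have h1 : q x <= q (x - s c) + q (s c) by apply: le_trans (qD _ _); rewrite subrK.
have h2 : q (x - s c) <= `|C| * N (x - s c).
  by apply: le_trans (qC _ Gc) _; rewrite ler_wpM2r ?ler_norm ?(cn_ge0 cN).
have h3 : `|C| * N (x - s c) <= `|C| * (N x + K * N x * E).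
  rewrite ler_wpM2l //; apply: le_trans (cnB cN _ _) _; rewrite lerD2l.
  by apply: le_trans (sN _) _; rewrite ler_wpM2r.
have h4 : q (s c) <= K * N x * Q by apply: le_trans (qs _) _; rewrite ler_wpM2r.
have -> : (`|C| * (1 + K * E) + K * Q) * N x = `|C| * (N x + K * N x * E) + K * N x * Q by ring.
lra.
Qed.

End NormInstances.

(** * The unitization *)

Local Open Scope banach_star_scope.

Section ProductTheory.
Variables (R : realType) (A : banachStarAlgType R).
Implicit Types (x y z : A).

Lemma amul0l x : 0 ** x = 0.
Proof. by have := amulZl 0 0 x; rewrite !scale0r. Qed.

Lemma amul0r x : x ** 0 = 0.
Proof. by have := amulZr 0 x 0; rewrite !scale0r. Qed.

Lemma amulNl x y : (- x) ** y = - (x ** y).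
Proof. by rewrite -(scaleN1r x) amulZl scaleN1r. Qed.

Lemma amulNr x y : x ** (- y) = - (x ** y).
Proof. by rewrite -(scaleN1r y) amulZr scaleN1r. Qed.

Lemma amulBl x y z : (x - y) ** z = x ** z - y ** z.
Proof. by rewrite amulDl amulNl. Qed.

Lemma amulBr x y z : x ** (y - z) = x ** y - x ** z.
Proof. by rewrite amulDr amulNr. Qed.

Lemma star0 : star (0 : A) = 0.
Proof. by rewrite -(scale0r 0) starZ rmorph0 !scale0r. Qed.

Definition nrm x : R := complex.Re `|x|.

Lemma nrm_complete : complete_norm nrm.
Proof. exact: complete_norm_normedMod. Qed.

Lemma nrmE x : (nrm x)%:C = `|x|.
Proof. by rewrite /nrm RRe_real ?normr_real. Qed.

Lemma nrm_amul x y : nrm (x ** y) <= nrm x * nrm y.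
Proof. by rewrite -lecR rmorphM /= !nrmE norm_amul. Qed.

End ProductTheory.

Section Unitization.
Variables (R : realType) (A : banachStarAlgType R).

Definition unitization : Type := (R[i]^o * A)%type.

HB.instance Definition _ := GRing.Lmodule.copy unitization (R[i]^o * A)%type.

Definition umul (p q : unitization) : unitization :=
  (p.1 * q.1, p.1 *: q.2 + q.1 *: p.2 + p.2 ** q.2).

Definition uone : unitization := (1, 0).

Let umulA : associative umul.
Proof.
move=> [a x] [b y] [c z]; rewrite /umul /=; congr (_, _); first exact: mulrA.
rewrite !scalerDr !amulDl !amulDr !amulZl !amulZr !scalerA amulA [c * a]mulrC [c * b]mulrC.
by rewrite !addrA [LHS](ACl (1*2*4*6*3*5*7)%AC).
Qed.

Let umul1 : left_id uone umul.
Proof.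
by move=> [a x]; rewrite /umul /= mul1r scale1r scaler0 amul0l !addr0.
Qed.

Let umul1r : right_id uone umul.
Proof.
by move=> [a x]; rewrite /umul /= mulr1 scale1r scaler0 amul0r addr0 add0r.
Qed.

Let umulDl : left_distributive umul +%R.
Proof.
move=> [a x] [b y] [c z]; rewrite /umul; congr (_, _); rewrite /=; first exact: mulrDl.
by rewrite scalerDl scalerDr amulDl !addrA [LHS](ACl (1*3*5*2*4*6)%AC).
Qed.

Let umulDr : right_distributive umul +%R.
Proof.
move=> [a x] [b y] [c z]; rewrite /umul; congr (_, _); rewrite /=; first exact: mulrDr.
by rewrite scalerDl scalerDr amulDr !addrA [LHS](ACl (1*3*5*2*4*6)%AC).
Qed.

Let uone_neq0 : uone != 0.
Proof. by apply/eqP => -[] /eqP; rewrite oner_eq0. Qed.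

HB.instance Definition _ := GRing.Zmodule_isNzRing.Build unitization
  umulA umul1 umul1r umulDl umulDr uone_neq0.

Let uscaleAl (a : R[i]) (p q : unitization) : a *: (p * q) = a *: p * q.
Proof.
case: p q => [b x] [c y]; congr (_, _); rewrite /=; first exact: mulrA.
by rewrite !scalerDr amulZl !scalerA [c * a]mulrC.
Qed.

HB.instance Definition _ := GRing.Lmodule_isLalgebra.Build R[i] unitization uscaleAl.

Let uscaleAr (a : R[i]) (p q : unitization) : a *: (p * q) = p * (a *: q).
Proof.
case: p q => [b x] [c y]; congr (_, _); rewrite /=; first exact: mulrCA.
by rewrite !scalerDr amulZr !scalerA [b * a]mulrC.
Qed.

HB.instance Definition _ := GRing.Lalgebra_isAlgebra.Build R[i] unitization uscaleAr.

Definition unorm (p : unitization) : R := cabs p.1 + nrm p.2.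

Lemma unorm_banach : banach_norm unorm.
Proof.
split.
- exact: complete_norm_prod (complete_norm_complex R) (nrm_complete A).
- move=> [a x] [b y]; rewrite /unorm /= cabsM.
  have cA := nrm_complete A.
  have := cn_triangle cA (a *: y + b *: x) (x ** y).
  have := cn_triangle cA (a *: y) (b *: x).
  rewrite !(cn_scale cA); have := nrm_amul x y; lra.
- by rewrite /unorm /= cabs1 (cn0 (nrm_complete A)) addr0.
Qed.

Definition ustar (p : unitization) : unitization := (Num.conj p.1, star p.2).

Lemma ustar_involution : involution ustar.
Proof.
split.
- by move=> [a x] [b y]; congr (_, _); rewrite /= ?rmorphD ?starD.
- by move=> c [a x]; congr (_, _); rewrite /= ?starZ //; exact: rmorphM.
- move=> [a x] [b y]; congr (_, _); rewrite /=.
    by rewrite rmorphM mulrC.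
  by rewrite !starD !starZ starM [_ *: star y + _]addrC.
- by move=> [a x]; congr (_, _); rewrite /= ?conjCK ?starK.
Qed.

(** Left multiplication of the unitization on its ideal [A], with values in [A] itself so that [f]
    can be applied. *)
Definition uact (p : unitization) (c : A) : A := p.1 *: c + p.2 ** c.

Lemma uactM p q c : uact (p * q) c = uact p (uact q c).
Proof.
case: p q => [a x] [b y]; rewrite /uact /=.
rewrite !scalerDr amulDr amulZr !scalerA !amulDl !amulZl amulA.
by rewrite !addrA.
Qed.

Lemma star_uact p c d : star c ** uact (ustar p) d = star (uact p c) ** d.
Proof.
case: p => [a x]; rewrite /uact /= starD starZ starM amulDr amulDl.
by rewrite amulZr amulZl amulA.
Qed.

End Unitization.

(** * Positive functionals *)

Lemma lin_spanS (K : pzRingType) (V : lmodType K) (S T : set V) :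
  S `<=` T -> lin_span S `<=` lin_span T.
Proof.
by move=> ST v [n [c [s [Ss ->]]]]; exists n, c, s; split=> // i; exact: ST.
Qed.

Lemma lin_span_ind (K : pzRingType) (V : lmodType K) (S P : set V) :
  P 0 -> (forall x y, P x -> P y -> P (x + y)) ->
  (forall (a : K) x, P x -> P (a *: x)) -> S `<=` P -> lin_span S `<=` P.
Proof.
move=> P0 PD PZ SP v [n [c [s [Ss ->]]]].
by elim/big_ind: _ => // i _; exact/PZ/SP.
Qed.

Lemma closed_approx (R : realType) (A : banachStarAlgType R) (W : set A) :
  closed W -> forall x, (forall e : R, 0 < e -> exists y, W y /\ nrm (x - y) <= e) -> W x.
Proof.
move=> clW x h; apply: clW => B /nbhs_ballP[e /= e0 hB].
have Ee : e = (complex.Re e)%:C by rewrite RRe_real // gtr0_real.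
have e0' : 0 < complex.Re e by rewrite -ltcR -Ee.
have [|y [Wy hy]] := h (complex.Re e / 2); first by rewrite divr_gt0.
exists y; split => //; apply: hB; rewrite -ball_normE /= -nrmE Ee ltcR.
by apply: le_lt_trans hy _; lra.
Qed.

Section Center.
Variables (R : realType) (A : banachStarAlgType R).
Implicit Types (x y z w : A).

Lemma center_star z : Defs.center A z -> Defs.center A (star z).
Proof. by move=> cz a; rewrite -(starK a) -!starM cz. Qed.

Lemma center0 : Defs.center A 0.
Proof. by move=> a; rewrite amul0l amul0r. Qed.

Lemma centerD z w : Defs.center A z -> Defs.center A w -> Defs.center A (z + w).
Proof. by move=> cz cw a; rewrite amulDl amulDr cz cw. Qed.

Lemma centerZ (c : R[i]) z : Defs.center A z -> Defs.center A (c *: z).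
Proof. by move=> cz a; rewrite amulZl amulZr cz. Qed.

Lemma centerB z w : Defs.center A z -> Defs.center A w -> Defs.center A (z - w).
Proof. by move=> cz cw; rewrite -scaleN1r; apply/centerD/centerZ. Qed.

Lemma centerM z w : Defs.center A z -> Defs.center A w -> Defs.center A (z ** w).
Proof. by move=> cz cw a; rewrite -amulA cw amulA cz amulA. Qed.

End Center.

Section PositiveFunctional.
Variables (R : realType) (A : banachStarAlgType R) (f : {scalar A}).
Hypothesis fpos : positive_functional f.
Implicit Types (a b c d u v w x y z : A).

Let fD x y : f (x + y) = f x + f y. Proof. exact: linearD. Qed.
Let fZ (t : R[i]) x : f (t *: x) = t * f x. Proof. exact: linearZ. Qed.

Definition gns x y : R[i] := f (star x ** y).

Lemma gns_sip : semi_inner_product gns.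
Proof.
split; rewrite /gns.
- by move=> x y z t; rewrite amulDr amulZr fD fZ.
- by move=> x y z t; rewrite starD starZ amulDl amulZl fD fZ.
- exact: fpos.
Qed.

Definition gns_norm x : R := sip_norm gns x.
Local Notation p := gns_norm.

Let p0 x : 0 <= p x. Proof. exact: sip_norm_ge0. Qed.
Let pD x y : p (x + y) <= p x + p y. Proof. exact: (sip_normD gns_sip). Qed.
Let pZ t x : p (t *: x) = cabs t * p x. Proof. exact: (sip_normZ gns_sip). Qed.
Let pB x y : p (x - y) <= p x + p y.
Proof. by apply: le_trans (pD _ _) _; rewrite -scaleN1r pZ cabsN cabs1 mul1r. Qed.
Let pE x : f (star x ** x) = (p x ^+ 2)%:C. Proof. exact: (sip_normE gns_sip). Qed.
Let f_le x y : cabs (f (x ** y)) <= p (star x) * p y.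
Proof. by rewrite -[x in f (x ** _)]starK; exact: (sip_bound gns_sip). Qed.

(** A positive [f] need not extend positively to the unitization, but [f(c' . c)] does, since [u c]
    stays in [A]. *)
Definition compression c (u : unitization A) : R[i] := f (star c ** uact u c).

Lemma compression_linear c : scalar (compression c).
Proof.
move=> t [a x] [b y]; rewrite /compression /uact /= -fZ -fD -amulZr -amulDr.
congr (f (_ ** _)); rewrite amulDl amulZl scalerDl scalerDr scalerA.
exact: addrACA.
Qed.

HB.instance Definition _ c := GRing.isLinear.Build R[i] (unitization A) R[i] _
  (compression c) (compression_linear c).

Lemma compression_pos c (u : unitization A) :
  0 <= compression c ((ustar u : unitization A) * u).
Proof. by rewrite /compression uactM star_uact; exact: fpos. Qed.

Lemma compressionE c x : compression c ((0, x) : unitization A) = f (star c ** x ** c).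
Proof. by rewrite /compression /uact /= scale0r add0r amulA. Qed.

Lemma compression_bounded c : exists C, 0 <= C /\
  forall x, cabs (f (star c ** x ** c)) <= C * nrm x.
Proof.
have [C [C0 hC]] := positive_functional_bounded (unorm_banach A) (ustar_involution A)
   (g := compression c) (compression_pos c).
exists C; split => // x; rewrite -compressionE.
by apply: le_trans (hC _) _; rewrite /unorm /= cabs0 add0r.
Qed.

(** Here the dependence on [c] is explicit, because the compressed functional takes the value
    [p c ^+ 2] at the unit. This makes multiplication by a central element bounded for [p]. *)
Lemma compression_hermitian c h : star h = h ->
  cabs (f (star c ** h ** c)) <= 4%:R * nrm h * p c ^+ 2.
Proof.
move=> hh; rewrite -compressionE.
have := hermitian_bound (unorm_banach A) (ustar_involution A)
   (g := compression c) (compression_pos c) (h := ((0, h) : unitization A)).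
rewrite /ustar /= hh rmorph0 => /(_ erefl); rewrite /unorm /= cabs0 add0r.
have -> : compression c 1 = (p c ^+ 2)%:C.
  by rewrite /compression /uact /= scale1r amul0l addr0 pE.
by [].
Qed.

Lemma two_sided_bounded b c : exists C, 0 <= C /\
  forall x, cabs (f (b ** x ** c)) <= C * nrm x.
Proof.
(* Polarization with [c + d] and [c + 'i d] only: the cross terms [f (star c ** x ** d)] cancel. *)
pose F y x := f (star y ** x ** y).
pose d := star b.
have [C1 [C10 h1]] := compression_bounded (c + d).
have [C2 [C20 h2]] := compression_bounded (c + 'i *: d).
have [C3 [C30 h3]] := compression_bounded c.
have [C4 [C40 h4]] := compression_bounded d.
exists (C1 + C2 + 2 * C3 + 2 * C4); split; first by lra.
move=> x; have Nx := cn_ge0 (nrm_complete A) x.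
have polar : 2 * f (b ** x ** c) =
   (F (c + d) x - F c x - F d x) + 'i * (F (c + 'i *: d) x - F c x - F d x).
  have ii : ('i : R[i]) * 'i = -1 by rewrite -expr2 sqr_i.
  have ci : Num.conj ('i : R[i]) = - 'i by rewrite conjCi.
  rewrite /F /d !starD starZ starK ci !(amulDl, amulDr, amulZl, amulZr) !(fD, fZ).
  rewrite !(mulrDr, mulrN, mulNr, mulrA) !ii; ring: ii.
have c2 : cabs (2 : R[i]) = 2 by rewrite -(rmorph_nat (real_complex R)) cabs_real ger0_norm.
have : 2 * cabs (f (b ** x ** c)) <= (C1 + C2 + 2 * C3 + 2 * C4) * nrm x.
  rewrite -c2 -cabsM polar; apply: le_trans (cabsD _ _) _; rewrite cabsM cabs_i mul1r.
  have t (r s q : R[i]) : cabs (r - s - q) <= cabs r + cabs s + cabs q.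
    apply: le_trans (cabsD _ _) _; rewrite cabsN lerD2r.
    by apply: le_trans (cabsD _ _) _; rewrite cabsN.
  have := t (F (c + d) x) (F c x) (F d x).
  have := t (F (c + 'i *: d) x) (F c x) (F d x).
  have := h1 x; have := h2 x; have := h3 x; have := h4 x; rewrite c2 /F.
  lra.
have := cabs_ge0 (f (b ** x ** c)); lra.
Qed.
Lemma gns_left_bounded z a : Defs.center A z -> exists C, 0 <= C /\
  forall x, cabs (gns (z ** a) x) <= C * nrm x.
Proof.
move=> /center_star cz; have [C [C0 hC]] := two_sided_bounded (star a) (star z).
exists C; split => // x; rewrite /gns starM -amulA cz amulA; exact: hC.
Qed.

Let ZA : set A := prod_space (Defs.center A) setT.

Let gns_left_bounded_span w : ZA w -> exists C, 0 <= C /\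
  forall x, cabs (gns w x) <= C * nrm x.
Proof.
have N0 x : 0 <= nrm x := cn_ge0 (nrm_complete A) x.
move: w; apply: lin_span_ind.
- exists 0; split=> // x; rewrite /gns star0 amul0l linear0 cabs0 mul0r.
  exact: lexx.
- move=> w w' [C [C0 hC]] [C' [C'0 hC']]; exists (C + C'); split; first exact: addr_ge0.
  move=> x; rewrite /gns starD amulDl fD; apply: le_trans (cabsD _ _) _.
  by rewrite mulrDl; apply: lerD; [exact: hC | exact: hC'].
- move=> t w [C [C0 hC]]; exists (cabs t * C); split; first by rewrite mulr_ge0 ?cabs_ge0.
  move=> x; rewrite /gns starZ amulZl fZ cabsM cabs_conj -mulrA.
  by rewrite ler_wpM2l ?cabs_ge0 //; exact: hC.
- by move=> _ [z [a [cz _ ->]]]; exact: gns_left_bounded.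
Qed.

(** Uniform boundedness is applied to the normalized functionals [<w, .> / p w], bounded at each [x]
    by [p x]; evaluation of the one for [w] at [w] itself returns [p w]. If [p w = 0] the quotient
    is 0 by convention. *)
Lemma gns_norm_bounded_ZA : exists C, 0 < C /\ forall w, ZA w -> p w <= C * nrm w.
Proof.
have [K hK] := choice (fun w : {w : A | ZA w} => gns_left_bounded_span (svalP w)).
have [||||||| C [C0 hC]] := @uniform_boundedness _ _ _ (nrm_complete A) (fun=> True)
  {w : A | ZA w} (fun i x => cabs (gns (sval i) x) / p (sval i))
  (fun i => K i / p (sval i)) => //.
- move=> w x y; rewrite -mulrDl ler_wpM2r ?invr_ge0 //.
  by rewrite /gns amulDr fD cabsD.
- by move=> w t x; rewrite /gns amulZr fZ cabsM cabs_real mulrA.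
- move=> w x _; rewrite mulrAC ler_wpM2r ?invr_ge0 //.
  by have [_] := hK w.
- move=> x _; exists (p x) => -[w Zw] /=.
  have [pw0|pwn0] := eqVneq (p w) 0; first by rewrite pw0 invr0 mulr0.
  rewrite ler_pdivrMr; last by rewrite lt_neqAle eq_sym pwn0 p0.
  by rewrite mulrC; exact: (sip_bound gns_sip).
exists C; split => // w Zw; have := hC (exist _ w Zw) w I.
rewrite /= {1}/gns pE cabs_real ger0_norm ?sqr_ge0 //.
have [->|pwn0] := eqVneq (p w) 0; first by rewrite expr0n mul0r.
by rewrite expr2 mulfK.
Qed.

Lemma ZA2_sub_ZA : ZA2 A `<=` ZA.
Proof.
by apply: lin_spanS => _ [z [w [cz _ ->]]]; exists z, w.
Qed.

(** * Continuity when [ZA2] is closed of finite codimension *)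

Section ClosedFiniteCodim.
Hypotheses (hclosed : closed (ZA2 A)) (hcodim : finite_codim (ZA2 A)).

Let bounded_of_ZA2 (q : A -> R) (C : R) :
  (forall x y, q (x + y) <= q x + q y) ->
  (forall t x, q (t *: x) = cabs t * q x) ->
  (forall x, ZA2 A x -> q x <= C * nrm x) ->
  exists C', forall x, q x <= C' * nrm x.
Proof.
move=> qD qZ qC; apply: (bounded_of_finite_codim (nrm_complete A)) qC => //.
- exact: lin_span0.
- exact: lin_spanD.
- by move=> t x; exact: lin_spanZ.
- exact: closed_approx.
Qed.

Lemma gns_norm_bounded : exists C, forall x, p x <= C * nrm x.
Proof.
have [C [_ hC]] := gns_norm_bounded_ZA.
apply: (bounded_of_ZA2 (C := C)) => // x /ZA2_sub_ZA; exact: hC.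
Qed.

(* [z] with [id - z] a contraction for the GNS seminorm; these play the role of
   a bounded approximate identity of the center. *)
Definition cocontraction z := Defs.center A z /\ forall v, p (v - z ** v) <= p v.

Lemma cocontraction_le2 z v : cocontraction z -> p (z ** v) <= 2 * p v.
Proof.
move=> [_ hz]; have := pB v (v - z ** v); rewrite opprB addrC subrK.
have := hz v; lra.
Qed.

(** The quasi-product: formally [1 - comp z z' = (1 - z') (1 - z)]. *)
Let comp z z' := z + z' - z' ** z.

Let compE z z' v : v - comp z z' ** v = (v - z ** v) - z' ** (v - z ** v).
Proof.
rewrite /comp amulBl amulDl amulBr amulA.
by rewrite -[z ** v + _ - _]addrA opprD addrA.
Qed.

Lemma cocontraction_comp z z' : cocontraction z -> cocontraction z' ->
  cocontraction (comp z z').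
Proof.
move=> [cz hz] [cz' hz']; split; first by apply: centerB; [exact: centerD | exact: centerM].
by move=> v; rewrite compE; apply: le_trans (hz' _) (hz v).
Qed.

(* With [T = w^* w / c <= 1] on the GNS space and [D = 1 - T],
   [|w v|^2 / c <= |v|^2 - |D v|^2]; summing over the orbit of [D],
   [n |D^n w v|^2 <= c |v|^2]. *)
Lemma approximate_unit w y (e : R) : Defs.center A w -> 0 < e ->
  exists z, cocontraction z /\ p (w ** y - z ** (w ** y)) <= e.
Proof.
move=> cw e0; have csw := center_star cw.
pose k := star w ** w.
have ck : Defs.center A k by exact: centerM.
pose c : R := 4%:R * nrm (w ** star w) + 1.
have c0 : 0 < c by rewrite ltr_wpDl // mulr_ge0 // (cn_ge0 (nrm_complete A)).
pose z1 := c^-1%:C *: k; have cz1 : Defs.center A z1 by exact: centerZ.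
(* Expansion gives [|v|^2 - 2 |w v|^2 / c + |k v|^2 / c^2]. Compressing the hermitian [w ** star w]
   by [w ** v] bounds [|k v|^2] by [c |w v|^2], which dictates [c]. *)
have key v : p (v - z1 ** v) ^+ 2 <= p v ^+ 2 - p (w ** v) ^+ 2 / c.
  have kE : gns v (k ** v) = (p (w ** v) ^+ 2)%:C.
    by rewrite -pE starM /gns /k !amulA.
  have kk : p (k ** v) ^+ 2 <= c * p (w ** v) ^+ 2.
    have h : star (w ** star w) = w ** star w by rewrite starM starK.
    have := compression_hermitian (w ** v) h.
    have -> : star (w ** v) ** (w ** star w) ** (w ** v) = star (k ** v) ** (k ** v).
      by rewrite /k !starM starK !amulA.
    rewrite pE cabs_real ger0_norm ?sqr_ge0 // => /le_trans; apply.
    by rewrite ler_wpM2r ?sqr_ge0 // /c lerDl.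
  have := sip_expand gns_sip v (k ** v) (- c^-1%:C).
  rewrite (sip_conj gns_sip v (k ** v)) kE.
  have -> : v + (- c^-1%:C) *: (k ** v) = v - z1 ** v.
    by rewrite scaleNr amulZl.
  rewrite !(sip_normE gns_sip) -/(p _) -/(p _) -/(p _).
  rewrite !conj_complexE -rmorphN !conjc_real -!rmorphM -!rmorphD => /complexI ->.
  have -> : - c^-1 * - c^-1 * p (k ** v) ^+ 2 = c^-1 * (c^-1 * p (k ** v) ^+ 2) by ring.
  have : c^-1 * (c^-1 * p (k ** v) ^+ 2) <= c^-1 * p (w ** v) ^+ 2.
    rewrite ler_pM2l ?invr_gt0 // -[leRHS]mul1r -(mulVf (lt0r_neq0 c0)) -mulrA.
    by rewrite ler_pM2l ?invr_gt0.
  lra.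
have co1 : cocontraction z1.
  split => // v; rewrite -(@ler_pXn2r _ 2) ?nnegrE //.
  apply: le_trans (key v) _; rewrite gerBl.
  by rewrite divr_ge0 ?sqr_ge0 // ltW.
pose zn n := iter n (fun z => comp z z1) 0.
have con n : cocontraction (zn n).
  elim: n => [|n IH] /=; last exact: cocontraction_comp.
  by split; [exact: center0 | move=> v; rewrite amul0l subr0].
(* Here [zn n] encodes [1 - D^n]. The estimate [key] telescopes along the orbit, and the terms
   [|D^j w v|] decrease, so [n] times the last one is below their sum. *)
have sum_le n v : n%:R * p (w ** v - zn n ** (w ** v)) ^+ 2
    <= c * (p v ^+ 2 - p (v - zn n ** v) ^+ 2).
  elim: n => [|n IH]; first by rewrite mul0r amul0l subr0 subrr mulr0.
  have [czn _] := con n.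
  have Dw : w ** v - zn n ** (w ** v) = w ** (v - zn n ** v).
    by rewrite amulBr !amulA czn.
  rewrite [zn n.+1]/= -/(zn n) !compE.
  have hk := key (v - zn n ** v).
  have [_ /(_ (w ** v - zn n ** (w ** v))) hco] := co1.
  have hsq : p (w ** v - zn n ** (w ** v) - z1 ** (w ** v - zn n ** (w ** v))) ^+ 2
       <= p (w ** v - zn n ** (w ** v)) ^+ 2.
    by apply: lerXn2r; rewrite ?nnegrE.
  rewrite -Dw in hk; rewrite -natr1 mulrDl mul1r.
  have h2 : n%:R * p (w ** v - zn n ** (w ** v) - z1 ** (w ** v - zn n ** (w ** v))) ^+ 2
     <= n%:R * p (w ** v - zn n ** (w ** v)) ^+ 2 by rewrite ler_wpM2l.
  have h3 : p (w ** v - zn n ** (w ** v)) ^+ 2 <=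
      c * (p (v - zn n ** v) ^+ 2 - p (v - zn n ** v - z1 ** (v - zn n ** v)) ^+ 2).
    by rewrite mulrC -ler_pdivrMr //; lra.
  lra.
pose n := Num.bound (c * p y ^+ 2 / e ^+ 2).
exists (zn n.+1); split; first exact: con.
rewrite -(@ler_pXn2r _ 2) ?nnegrE ?(ltW e0) //.
have n0 : (0 : R) < n.+1%:R by rewrite ltr0n.
rewrite -(ler_pM2l n0); apply: le_trans (sum_le _ _) _.
apply: (@le_trans _ _ (c * p y ^+ 2)).
  by rewrite ler_pM2l // gerBl sqr_ge0.
have hb : c * p y ^+ 2 / e ^+ 2 < n%:R.
  by rewrite archi_boundP // divr_ge0 ?sqr_ge0 // mulr_ge0 ?sqr_ge0 // ltW.
rewrite -ler_pdivrMr ?exprn_gt0 //; apply: le_trans (ltW hb) _.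
by rewrite ler_nat.
Qed.

(** Formally [1 - z' = (1 - d) (1 - z)]: a preorder directed by [comp]. Elements of [ZA2] are sums,
    so approximations found for the summands must survive passage to a common [z]. *)
Let finer z' z := exists2 d, cocontraction d &
  forall v, v - z' ** v = (v - z ** v) - d ** (v - z ** v).

Let finer_refl z : finer z z.
Proof.
exists 0; last by move=> v; rewrite amul0l subr0.
by split; [exact: center0 | move=> v; rewrite amul0l subr0].
Qed.

Let finer_trans z1 z2 z3 : finer z3 z2 -> finer z2 z1 -> finer z3 z1.
Proof.
move=> [d cd hd] [d' cd' hd']; exists (comp d' d); first exact: cocontraction_comp.
by move=> v; rewrite hd hd' compE.
Qed.

Let finer_comp z z' : cocontraction z -> cocontraction z' ->
  finer (comp z z') z /\ finer (comp z z') z'.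
Proof.
move=> cz cz'; split; first by exists z' => // v; exact: compE.
exists z => // v; rewrite -compE /comp [z + z']addrC.
by have [-> _] := cz.
Qed.

Let eventually_close u := forall e : R, 0 < e -> exists2 z, cocontraction z &
  forall z', cocontraction z' -> finer z' z -> cabs (f (u - z' ** u)) <= e.

(** As [p] alone does not control [f], centrality moves [1 - z'] behind [x], so that [f] is
    estimated by [p (star x)] times [p] of the defect of [w ** y], and passing to a finer [z'] only
    shrinks the latter. *)
Lemma ZA2_eventually_close u : ZA2 A u -> forall e : R, 0 < e ->
  exists2 z, cocontraction z & cabs (f (u - z ** u)) <= e.
Proof.
move=> Zu e e0; suff /(_ e e0)[z cz hz] : eventually_close u.
  by exists z => //; apply: hz => //; exact: finer_refl.
move: u Zu {e e0}; rewrite ZA2E; apply: lin_span_ind.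
- move=> e e0; exists 0; first by split; [exact: center0 | move=> v; rewrite amul0l subr0].
  by move=> z _ _; rewrite amul0r subr0 linear0 cabs0 ltW.
- move=> x y hx hy e e0; have e2 : 0 < e / 2 by rewrite divr_gt0.
  have [z1 c1 h1] := hx _ e2; have [z2 c2 h2] := hy _ e2.
  exists (comp z1 z2); first exact: cocontraction_comp.
  have [f1 f2] := finer_comp c1 c2 => z cz hz.
  have := h1 z cz (finer_trans hz f1); have := h2 z cz (finer_trans hz f2).
  rewrite amulDr opprD addrACA (fD (x - z ** x)).
  have := cabsD (f (x - z ** x)) (f (y - z ** y)); lra.
- move=> t x hx e e0; have t0 := cabs_ge0 t.
  have t1 : 0 < cabs t + 1 by rewrite ltr_wpDl.
  have [|z cz hz] := hx (e / (cabs t + 1)); first by rewrite divr_gt0.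
  exists z => // z' cz' /(hz z' cz') h; rewrite amulZr -scalerBr fZ cabsM.
  apply: le_trans (ler_wpM2l t0 h) _; rewrite mulrCA -[leRHS]mulr1.
  by rewrite ler_pM2l // ler_pdivrMr // mul1r lerDl.
- move=> _ [w [x [y [cw ->]]]] e e0.
  have px : 0 < p (star x) + 1 by rewrite ltr_wpDl.
  have [|z [cz hz]] := approximate_unit (w := w) y (e := e / (p (star x) + 1)) cw.
    by rewrite divr_gt0.
  exists z => // z' [cz' _] [d [_ hd] E].
  have -> : w ** (x ** y) - z' ** (w ** (x ** y)) = x ** (w ** y - z' ** (w ** y)).
    by rewrite amulBr !amulA -(cz' x) -!amulA (cw (x ** y)) -amulA -cw.
  rewrite E; apply: le_trans (f_le _ _) _.
  apply: (@le_trans _ _ (p (star x) * (e / (p (star x) + 1)))).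
    by rewrite ler_wpM2l //; apply: le_trans (hd _) hz.
  rewrite mulrCA -[leRHS]mulr1 ler_pM2l //.
  by rewrite ler_pdivrMr // mul1r lerDl.
Qed.

Lemma positive_functional_nrm_bounded : exists C, forall x, cabs (f x) <= C * nrm x.
Proof.
have [C hC] := gns_norm_bounded.
have N0 x : 0 <= nrm x := cn_ge0 (nrm_complete A) x.
pose I := {z : A | cocontraction z}.
(* Boundedness of each single functional, with a constant depending on [star z], is where the
   continuity of [p] is used; closedness of [ZA2] lets the principle run inside that subspace. *)
have [||||||| K [K0 hK]] := @uniform_boundedness _ _ _ (nrm_complete A) (ZA2 A)
  I (fun i x => cabs (f (sval i ** x))) (fun i => p (star (sval i)) * C).
- exact: lin_spanD.
- by move=> t x; exact: lin_spanZ.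
- exact: closed_approx.
- by move=> i x y; rewrite amulDr fD cabsD.
- by move=> i t x; rewrite amulZr fZ cabsM cabs_real.
- move=> i x _; apply: le_trans (f_le _ _) _.
  by rewrite -mulrA ler_wpM2l.
- rewrite ZA2E; apply: lin_span_ind.
  + by exists 0 => i; rewrite amul0r linear0 cabs0.
  + move=> x y [M hM] [M' hM']; exists (M + M') => i; rewrite amulDr fD.
    exact: le_trans (cabsD _ _) (lerD (hM i) (hM' i)).
  + move=> t x [M hM]; exists (cabs t * M) => i; rewrite amulZr fZ cabsM.
    by rewrite ler_wpM2l ?cabs_ge0 ?hM.
  + move=> _ [w [x [y [cw ->]]]]; exists (p (star (w ** x)) * (2 * p y)) => -[z cz] /=.
    have [cz' _] := cz.
    have -> : z ** (w ** (x ** y)) = (w ** x) ** (z ** y).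
      by rewrite !amulA -(cz' (w ** x)) !amulA.
    apply: le_trans (f_le _ _) _; rewrite ler_wpM2l //.
    exact: cocontraction_le2.
apply: (bounded_of_ZA2 (C := K)).
- by move=> x y; rewrite fD cabsD.
- by move=> t x; rewrite fZ cabsM.
move=> u Zu; apply: le_of_forall_eps => e e0.
have [z cz hz] := ZA2_eventually_close Zu e0.
have := hK (exist _ z cz) u Zu => /= h.
have := cabsD (f (z ** u)) (f (u - z ** u)).
rewrite -fD addrC subrK; lra.
Qed.

End ClosedFiniteCodim.

End PositiveFunctional.

Theorem theorem2 (R : realType) (A : banachStarAlgType R)
    (hclosed : closed (ZA2 A)) (hcodim : finite_codim (ZA2 A)) :
  forall f : {scalar A}, positive_functional f -> continuous (f : A -> R[i]^o).
Proof.
move=> f fpos; have [C hC] := positive_functional_nrm_bounded fpos hclosed hcodim.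
move=> x; apply/(@cvgrPdist_le _ R[i]^o) => e e0.
have Ee : e = (complex.Re e)%:C by rewrite RRe_real // gtr0_real.
have e0' : 0 < complex.Re e by rewrite -ltcR -Ee.
have C1 : 0 < `|C| + 1 by rewrite ltr_wpDl.
have d0 : 0 < (complex.Re e / (`|C| + 1))%:C by rewrite ltcR divr_gt0.
apply/nbhs_ballP; exists (complex.Re e / (`|C| + 1))%:C => //= y.
rewrite -ball_normE /= -nrmE ltcR => hy.
rewrite -linearB /= -cabsE Ee lecR; apply: le_trans (hC _) _.
have N0 := cn_ge0 (nrm_complete A) (x - y).
apply: (@le_trans _ _ ((`|C| + 1) * nrm (x - y))).
  by rewrite ler_wpM2r // (le_trans (ler_norm _)) // lerDl.
by rewrite mulrC -ler_pdivlMr // ltW.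
Qed.
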